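(* Let $X$ be a real normed space (of arbitrary, possibly infinite, dimension) and let $X^*$ be its dual space with the dual norm. Then the girth of $X$ equals the girth of $X^*$.
   Context: For a real normed space $X$ with unit sphere $\mathcal S=\{x\in X:\|x\|=1\}$, the girth of $X$ is the infimum of the lengths (measured with the norm of $X$) of all closed, rectifiable, centrally symmetric curves lying on $\mathcal S$. Centrally symmetric means invariant under the antipodal map $x\mapsto -x$. The infimum of the empty set is $+\infty$. The dual $X^*$ is the space of continuous linear functionals on $X$ with the norm $\|\xi\|^*=\sup_{\|x\|\le 1}|\xi(x)|$. *)

(* Defs.v *)
From HB Require Import structures.
From mathcomp Require Import all_boot all_order all_algebra.
From mathcomp Require Import all_classical all_reals all_analysis.

Set Implicit Arguments.
Unset Strict Implicit.
Unset Printing Implicit Defensive.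

Import Order.TTheory GRing.Theory Num.Theory.
Import numFieldTopology.Exports numFieldNormedType.Exports.

Local Open Scope classical_set_scope.
Local Open Scope ring_scope.

Section Dual.
Context {R : realType} (X : normedModType R).

Definition continuous_functional : {pred X -> R^o} :=
  mem [set f : X -> R^o | linear f /\ continuous f].

Record dual_space := Dual {
  dual_fun :> X -> R^o;
  dual_funP : dual_fun \in continuous_functional }.

HB.instance Definition _ := [isSub for dual_fun].
HB.instance Definition _ := [Choice of dual_space by <:].

Lemma continuous_functional_submod_closed :
  submod_closed continuous_functional.
Proof.
split=> [|a f g]; rewrite !inE /=.
  split; first by move=> k x y /=; rewrite scaler0 addr0.
  by move=> x; exact: cvg_cst.
move=> [lf cf] [lg cg]; split.
  move=> k x y; rewrite /= !fctE lf lg !scalerDr !scalerA (mulrC a k).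
  by rewrite -!addrA; congr (_ + _); rewrite addrCA.
by move=> x; apply: cvgD; [apply: cvgZr; exact: cf | exact: cg].
Qed.

HB.instance Definition _ := GRing.isSubmodClosed.Build R (X -> R^o)
  continuous_functional continuous_functional_submod_closed.
HB.instance Definition _ := [SubChoice_isSubLmodule of dual_space by <:].

Definition dual_norm (f : dual_space) : R :=
  sup [set `|f x| | x in [set x : X | `|x| <= 1]].

Lemma dual_linear (f : dual_space) : linear f.
Proof. by case: f => f /=; rewrite inE => -[]. Qed.

Lemma dual_continuous (f : dual_space) : continuous f.
Proof. by case: f => f /=; rewrite inE => -[]. Qed.

HB.instance Definition _ (f : dual_space) :=
  GRing.isLinear.Build R X R^o *:%R (dual_fun f) (@dual_linear f).

Lemma dual_norm_has_ubound (f : dual_space) :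
  has_ubound [set `|f x| | x in [set x : X | `|x| <= 1]].
Proof.
have /linear_bounded_continuous/linear_boundedP/pinfty_ex_gt0[M M0 fM] :=
  @dual_continuous f.
exists M => _ [x /= x1 <-]; apply: le_trans (fM x) _.
by rewrite ler_piMr// ltW.
Qed.

Lemma dual_norm_ub (f : dual_space) x : `|x| <= 1 -> `|f x| <= dual_norm f.
Proof.
by move=> x1; apply: ub_le_sup; [exact: dual_norm_has_ubound | exists x].
Qed.

Lemma dual_norm_le (f : dual_space) M :
  (forall x, `|x| <= 1 -> `|f x| <= M) -> dual_norm f <= M.
Proof.
move=> fM; apply: ge_sup; first by exists `|f 0|, 0 => //=; rewrite normr0.
by move=> _ [x /= x1 <-]; exact: fM.
Qed.

Lemma dual_norm_ge0 (f : dual_space) : 0 <= dual_norm f.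
Proof. by apply: le_trans (@dual_norm_ub f 0 _); rewrite ?normr0. Qed.

Lemma ler_dual_normD (f g : dual_space) :
  dual_norm (f + g) <= dual_norm f + dual_norm g.
Proof.
apply: dual_norm_le => x x1.
by rewrite (le_trans (ler_normD _ _))// lerD// dual_norm_ub.
Qed.

Lemma dual_normZ (a : R) (f : dual_space) : dual_norm (a *: f) = `|a| * dual_norm f.
Proof.
have Zle b (g : dual_space) : dual_norm (b *: g) <= `|b| * dual_norm g.
  by apply: dual_norm_le => x x1; rewrite normrM ler_wpM2l// dual_norm_ub.
have [->|a0] := eqVneq a 0.
  apply/eqP; rewrite normr0 mul0r eq_le dual_norm_ge0 andbT.
  by rewrite (le_trans (Zle _ _))// normr0 mul0r.
apply/eqP; rewrite eq_le Zle/= -ler_pdivlMl ?normr_gt0// -normfV.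
by rewrite -[leLHS](_ : dual_norm (a^-1 *: (a *: f)) = _) ?Zle// scalerK.
Qed.

Lemma dual_norm0_eq0 (f : dual_space) : dual_norm f = 0 -> f = 0.
Proof.
move=> f0; apply/val_inj/funext => x /=.
have [->|x0] := eqVneq x 0; first by rewrite linear0.
have xE : x = `|x| *: (`|x|^-1 *: x) by rewrite scalerKV ?normr_eq0.
rewrite xE linearZ/=; apply/eqP; rewrite scaler_eq0 normr_eq0 (negPf x0)/=.
rewrite -normr_le0 -f0 dual_norm_ub// normrZ normfV normr_id.
by rewrite mulVf ?normr_eq0.
Qed.

HB.instance Definition _ := Lmodule_isNormed.Build R dual_space
  ler_dual_normD dual_normZ dual_norm0_eq0.

Lemma dual_normE (f : dual_space) : `|f| = dual_norm f.
Proof. by []. Qed.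

End Dual.

Section Girth.
Context {R : realType} {V : normedModType R}.
Implicit Types (c : R -> V) (s : seq R).

Definition unit_sphere : set V := [set x | `|x| = 1].

(* [variation] of numfun.v, for a function with values in a normed space. *)
Definition polygon_length (a b : R) c s : R := let F := c \o nth b (a :: s) in
  \sum_(0 <= n < size s) `|F n.+1 - F n|.

Definition curve_length (a b : R) c : \bar R :=
  ereal_sup [set (polygon_length a b c s)%:E | s in itv_partition a b].

(* A closed curve is given by a parametrization on [0, 1] that takes the same
   value at both ends; it need not be simple.  Central symmetry is a condition
   on the set of points of the curve, not on the parametrization. *)
Definition symmetric_sphere_curve c : Prop :=
  [/\ {within `[0, 1], continuous c},
      c 0 = c 1,
      c @` `[0, 1] `<=` unit_sphere,
      (curve_length 0 1 c < +oo)%E &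
      -%R @` (c @` `[0, 1]) = c @` `[0, 1]].

End Girth.

Definition girth {R : realType} (V : normedModType R) : \bar R :=
  ereal_inf [set curve_length 0 1 c | c in @symmetric_sphere_curve R V].

(* Main.v *)
From HB Require Import structures.
Require Import Defs.
From mathcomp Require Import all_boot all_order all_algebra.
From mathcomp Require Import all_classical all_reals all_analysis.
From mathcomp Require Import ring lra.
Set Implicit Arguments.
Unset Strict Implicit.
Unset Printing Implicit Defensive.
Import Order.TTheory GRing.Theory Num.Theory.
Import numFieldTopology.Exports numFieldNormedType.Exports.
Local Open Scope classical_set_scope.
Local Open Scope ring_scope.

(** The statement is symmetrised first.  Let X and Y be normed spaces with a
    bilinear form B such that B x y <= |x| |y| and such that each unit ball
    computes the norm of the other space ([dual_pairing]).  This hypothesis does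
    not distinguish X from Y, and evaluation is such a form on a space and its
    dual ([dual_pairing_eval], by Hahn-Banach), so the inequality
    girth Y <= girth X ([girth_le_dual_pairing]) gives both halves.

    The geometric idea is visible when everything is smooth.  A shortest
    symmetric curve x(t) on the sphere of X, parametrised by arc length, is a
    geodesic of the sphere: the functional z(t) that norms the velocity x'(t)
    satisfies z' = - m n, where n(t) is the functional of norm one that norms
    x(t).  Hence z is a symmetric curve on the dual sphere, with speed m, and
    the integral of (z(x))' = 1 - m over the closed curve vanishes: x and z have
    the same length.

    In general the sphere is not smooth and there is no shortest curve, so the
    argument is run for polygons, with errors.  A curve is replaced by a
    polygon with many short edges whose end point is the opposite of its
    starting point.  The unit ball is replaced by a convex body that contains
    a slightly smaller ball and avoids the (slightly enlarged) polygon.  It is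
    cut out by a smooth function of finitely many functionals, so that
    staying outside this body has, at each point, a linear strengthening
    1 <= B y n, which nearby outer points can violate only to second order
    ([smooth_outer_region]).  Among the polygons with vertices in this outer
    region, one takes an almost minimiser of the longest edge.  The linearised
    problem is convex, and its Lagrange multipliers m_i
    ([lagrange_multipliers]) define a polygon Z in Y with edges - m_i n_i.
    Three facts make Z the dual curve ([discrete_duality]).  Its length is
    controlled because the sum of the m_i is the minimal edge length.  By
    summation by parts, near optimality says that the norm of Z_j is almost
    attained on the direction of the j-th edge of the first polygon.  By
    smoothness, n_j almost vanishes on this direction, so the norm decreases
    very little along each edge of Z; as Z ends at - Z_0, it is then almost
    constant.  Finally a polygon of almost constant norm can be projected
    radially onto the sphere at almost no cost in length
    ([arc_of_thin_polygon]), although radial projection alone may double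
    lengths. *)

(** * A Hahn-Banach theorem for cones *)
Section HahnBanach.
Context {R : realType} {V : lmodType R}.
Implicit Types (P Q f : V -> R) (K : V -> R -> Prop).

(** Homogeneity is only required as an inequality: it is what constructions by
    infima give, and applied to the inverse scalar it yields the equality. *)
Definition sublinear P :=
  (forall x y, P (x + y) <= P x + P y) /\
  (forall a x, 0 <= a -> P (a *: x) <= a * P x).

(** The predicate [linear] of the algebraic hierarchy would need [R^o] as target;
    here the functionals are real-valued. *)
Definition is_linear f :=
  (forall x y, f (x + y) = f x + f y) /\ (forall a x, f (a *: x) = a * f x).

(** A convex cone in V x R, written as a relation.  An element (k, s) stands for
    the constraint 0 <= f k + s on a functional f. *)
Definition weighted_cone K :=
  [/\ K 0 0, forall k s k' s', K k s -> K k' s' -> K (k + k') (s + s') &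
      forall a k s, 0 <= a -> K k s -> K (a *: k) (a * s)].

Lemma sublinear0 P : sublinear P -> P 0 = 0.
Proof.
move=> [PD PZ]; apply/eqP; rewrite eq_le; apply/andP; split.
  by rewrite -[leLHS](congr1 P (scale0r 0)) (le_trans (PZ _ _ _))// mul0r.
by have := PD 0 0; rewrite addr0 -lerBlDr subrr.
Qed.

Lemma sublinear_oppr_ge P x : sublinear P -> - P (- x) <= P x.
Proof.
move=> sP; have := sP.1 x (- x).
by rewrite subrr (sublinear0 sP) -lerBlDr sub0r.
Qed.

(** Q x is the infimum of P (x + k) + s over the cone.  It is finite because
    P (x + k) + s >= P k + s - P (- x), and the choice x = - k gives the last
    claim. *)
Lemma sublinear_infimal P K : sublinear P -> weighted_cone K ->
  (forall k s, K k s -> 0 <= P k + s) ->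
  exists Q, [/\ sublinear Q, forall x, Q x <= P x &
    forall k s, K k s -> Q (- k) <= s].
Proof.
move=> sP [K0 KD KZ] PK.
pose S x := [set P (x + k.1) + k.2 | k in [set k : V * R | K k.1 k.2]].
have SP x k s : K k s -> S x (P (x + k) + s) by move=> Kk; exists (k, s).
have Sn x : S x !=set0 by exists (P (x + 0) + 0); exact: SP.
have Slb x : has_lbound (S x).
  exists (- P (- x)) => _ [[k s] /= Kk <-].
  have := sP.1 (x + k) (- x); rewrite addrAC subrr add0r.
  have := PK _ _ Kk; lra.
have Qle x k s : K k s -> inf (S x) <= P (x + k) + s.
  by move=> Kk; apply: ge_inf => //; exact: SP.
exists (fun x => inf (S x)); split.
- split=> [x y|a x].
    rewrite -lerBlDr; apply: lb_le_inf => // _ [[k s] /= Kk <-].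
    rewrite lerBlDr -lerBlDl; apply: lb_le_inf => // _ [[k' s'] /= Kk' <-].
    rewrite lerBlDl; apply: le_trans (Qle _ _ _ (KD _ _ _ _ Kk Kk')) _.
    by have := sP.1 (x + k) (y + k'); rewrite addrACA; lra.
  rewrite le_eqVlt => /predU1P[<-|a0].
    rewrite scale0r mul0r (le_trans (Qle _ _ _ K0))// !addr0.
    by rewrite (sublinear0 sP).
  rewrite mulrC -ler_pdivrMr//; apply: lb_le_inf => // _ [[k s] /= Kk <-].
  rewrite ler_pdivrMr// (le_trans (Qle _ _ _ (KZ _ _ _ (ltW a0) Kk)))//.
  rewrite -scalerDr mulrDl [s * a]mulrC lerD2r mulrC.
  by apply: sP.2; exact: ltW.
- by move=> x; rewrite (le_trans (Qle _ _ _ K0))// !addr0.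
- by move=> k s Kk; rewrite (le_trans (Qle _ _ _ Kk))// addNr (sublinear0 sP) add0r.
Qed.

(** Zorn's lemma for the reverse pointwise order: a chain of sublinear
    functionals below P is bounded below pointwise by - P (- x), and its infimum
    is again sublinear. *)
Lemma minimal_sublinear P : sublinear P ->
  exists Q, [/\ sublinear Q, forall x, Q x <= P x &
    forall Q', sublinear Q' -> (forall x, Q' x <= Q x) -> Q' = Q].
Proof.
move=> sP; pose T := {Q | sublinear Q /\ forall x, Q x <= P x}.
pose D (Q Q' : T) := `[< forall x, sval Q' x <= sval Q x >].
have [||||Q Qmin] := @Zorn T D.
- by move=> Q; apply/asboolP.
- move=> Q1 Q2 Q3 /asboolP Q12 /asboolP Q23; apply/asboolP => x.
  exact: le_trans (Q23 x) (Q12 x).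
- move=> [Q1 h1] [Q2 h2] /asboolP /= Q12 /asboolP /= Q21.
  have Q1E : Q1 = Q2 by apply/funext => x; apply/eqP; rewrite eq_le Q12 Q21.
  by move: h1 h2 {Q12 Q21}; rewrite Q1E => h1 h2; rewrite (Prop_irrelevance h1 h2).
- move=> A Atot; have [[Q0 AQ0]|A0] := pselect (A !=set0); last first.
    exists (exist _ P (conj sP (fun=> lexx _))) => Q AQ.
    by case: A0; exists Q.
  pose S x := [set sval Q x | Q in A].
  have Slb x : has_lbound (S x).
    exists (- P (- x)) => _ [Q AQ <-].
    have [sQ QP] := svalP Q.
    by apply: le_trans (sublinear_oppr_ge x sQ); rewrite lerN2.
  have Sn x : S x !=set0 by exists (sval Q0 x); exists Q0.
  have Sle x (Q : T) : A Q -> inf (S x) <= sval Q x.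
    by move=> AQ; apply: ge_inf => //; exists Q.
  have sS : sublinear (fun x => inf (S x)).
    split=> [x y|a x].
      rewrite -lerBlDr; apply: lb_le_inf => // _ [Q1 AQ1 <-].
      rewrite lerBlDr -lerBlDl; apply: lb_le_inf => // _ [Q2 AQ2 <-].
      rewrite lerBlDl.
      case: (Atot _ _ AQ1 AQ2) => /asboolP le12.
        apply: le_trans (Sle _ _ AQ2) _.
        apply: le_trans ((svalP Q2).1.1 _ _) _.
        exact: lerD.
      apply: le_trans (Sle _ _ AQ1) _.
      apply: le_trans ((svalP Q1).1.1 _ _) _.
      exact: lerD.
    rewrite le_eqVlt => /predU1P[<-|a0].
      rewrite scale0r mul0r (le_trans (Sle _ _ AQ0))//.
      by rewrite (sublinear0 (svalP Q0).1).
    rewrite mulrC -ler_pdivrMr//; apply: lb_le_inf => // _ [Q AQ <-].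
    rewrite ler_pdivrMr// (le_trans (Sle _ _ AQ))// mulrC.
    by apply: (svalP Q).1.2; exact: ltW.
  have SleP x : inf (S x) <= P x.
    exact: le_trans (Sle _ _ AQ0) ((svalP Q0).2 x).
  exists (exist _ (fun x => inf (S x)) (conj sS SleP)) => Q AQ; apply/asboolP => x /=.
  exact: Sle.
exists (sval Q); have [sQ QP] := svalP Q; split => // Q' sQ' Q'Q.
have Q'P x : Q' x <= P x by exact: le_trans (Q'Q x) (QP x).
have := Qmin (exist _ Q' (conj sQ' Q'P)) => <-//.
exact/asboolP.
Qed.

(** Tilting Q along the ray of x gives a sublinear functional below Q whose
    value at - x is at most - Q x.  By minimality it is Q itself, so Q is odd,
    and an odd sublinear functional is linear. *)
Lemma minimal_sublinear_linear Q : sublinear Q ->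
  (forall Q', sublinear Q' -> (forall x, Q' x <= Q x) -> Q' = Q) ->
  is_linear Q.
Proof.
move=> sQ Qmin.
have QN x : Q (- x) = - Q x.
  pose K (k : V) (s : R) := exists2 t : R, 0 <= t & k = t *: x /\ s = - (t * Q x).
  have [||Q' [sQ' Q'Q Q'K]] := @sublinear_infimal Q K sQ.
  - split.
    + by exists 0 => //; rewrite scale0r mul0r oppr0.
    + move=> _ _ _ _ [t t0 [-> ->]] [t' t'0 [-> ->]].
      by exists (t + t'); rewrite ?addr_ge0// scalerDl mulrDl opprD.
    + move=> a _ _ a0 [t t0 [-> ->]].
      by exists (a * t); rewrite ?mulr_ge0// scalerA -mulrA mulrN.
  - move=> _ _ [t t0 [-> ->]]; rewrite subr_ge0.
    move: t0; rewrite le_eqVlt => /predU1P[<-|t0].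
      by rewrite mul0r scale0r (sublinear0 sQ).
    have := sQ.2 t^-1 (t *: x); rewrite invr_ge0 (ltW t0) => /(_ isT).
    by rewrite scalerA mulVf ?gt_eqF// scale1r ler_pdivlMl.
  - apply/eqP; rewrite eq_le; apply/andP; split.
      rewrite -(Qmin _ sQ' Q'Q); apply: Q'K; rewrite (Qmin _ sQ' Q'Q).
      by exists 1 => //; rewrite scale1r mul1r.
    by have := sublinear_oppr_ge x sQ; rewrite lerNl.
have QD x y : Q (x + y) = Q x + Q y.
  apply/eqP; rewrite eq_le sQ.1 /=.
  have := sQ.1 (x + y) (- y); rewrite addrK QN; lra.
have QZ a x : 0 <= a -> Q (a *: x) = a * Q x.
  move=> a0; apply/eqP; rewrite eq_le sQ.2//= -[leRHS]opprK -QN -scalerN.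
  by rewrite lerNr -mulrN -QN sQ.2.
split=> // a x; have [a0|a0] := leP 0 a; first exact: QZ.
by rewrite -[LHS]opprK -QN -scaleNr QZ ?oppr_ge0 1?ltW// mulNr opprK.
Qed.

(** Both uses below are choices of the cone: a ray forces a functional to norm a
    given vector, and the cone of values of constraints forces multipliers. *)
Theorem hahn_banach_cone P K : sublinear P -> weighted_cone K ->
  (forall k s, K k s -> 0 <= P k + s) ->
  exists f, [/\ is_linear f, forall x, f x <= P x &
    forall k s, K k s -> 0 <= f k + s].
Proof.
move=> sP wK PK; have [Q [sQ QP QK]] := sublinear_infimal sP wK PK.
have [f [sf fQ fmin]] := minimal_sublinear sQ.
have lf := minimal_sublinear_linear sf fmin.
exists f; split=> // [x|k s Kk]; first exact: le_trans (fQ x) (QP x).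
have := le_trans (fQ (- k)) (QK _ _ Kk).
by rewrite -scaleN1r lf.2 mulN1r; lra.
Qed.

End HahnBanach.

(** * Lagrange multipliers *)
Section Multipliers.
Context {R : realType}.

Lemma linear_suml {V : lmodType R} (f : V -> R) I (r : seq I) (F : I -> V) :
  is_linear f -> f (\sum_(i <- r) F i) = \sum_(i <- r) f (F i).
Proof.
move=> [fD fZ]; apply: (big_morph f) => //.
by rewrite -[X in f X](scale0r 0) fZ mul0r.
Qed.

Definition rowmax n (r : 'rV[R]_n.+1) := \big[Num.max/r 0 ord0]_i r 0 i.

Lemma rowmax_ge n (r : 'rV[R]_n.+1) i : r 0 i <= rowmax r.
Proof. exact: le_bigmax. Qed.

Lemma rowmax_le n (r : 'rV[R]_n.+1) M : (forall i, r 0 i <= M) -> rowmax r <= M.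
Proof. by move=> rM; apply: bigmax_le. Qed.

Lemma sublinear_rowmax n h : 0 <= h ->
  sublinear (fun r : 'rV[R]_n.+1 => h * rowmax r).
Proof.
move=> h0; split=> [r r'|a r a0].
  rewrite -mulrDr ler_wpM2l//; apply: rowmax_le => i.
  by rewrite mxE lerD// rowmax_ge.
rewrite mulrCA ler_wpM2l//; apply: rowmax_le => i.
by rewrite mxE ler_wpM2l// rowmax_ge.
Qed.

(** The multipliers are the coordinates of a functional on R^n that is bounded
    by h times the maximum of the coordinates, which forces nonnegative
    coordinates of sum h, and is nonnegative on the cone of the pairs
    (- N w, s) with G w <= s, which is the inequality for G.  Such a functional
    exists because h * max (- N w) + G w >= 0: when all the N i w are positive,
    rescale w until the least of them is 1. *)
Theorem lagrange_multipliers {W : lmodType R} n (G : W -> R)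
    (N : 'I_n.+1 -> W -> R) h :
  sublinear G -> (forall w, 0 <= G w) -> (forall i, is_linear (N i)) -> 0 <= h ->
  (forall w, (forall i, 1 <= N i w) -> h <= G w) ->
  exists m : 'I_n.+1 -> R, [/\ forall i, 0 <= m i, \sum_i m i = h &
    forall w, \sum_i m i * N i w <= G w].
Proof.
move=> sG G0 lN h0 hG.
pose K (k : 'rV[R]_n.+1) s := exists2 w, k = - \row_i N i w & G w <= s.
have wK : weighted_cone K.
  split.
  - exists 0; last by rewrite (sublinear0 sG).
    apply/rowP => i; rewrite !mxE -[X in N i X](scale0r 0) (lN i).2.
    by rewrite mul0r oppr0.
  - move=> _ s _ s' [w -> ws] [w' -> ws']; exists (w + w').
      by apply/rowP => i; rewrite !mxE (lN i).1 opprD.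
    by rewrite (le_trans (sG.1 _ _))// lerD.
  - move=> a _ s a0 [w -> ws]; exists (a *: w).
      by apply/rowP => i; rewrite !mxE (lN i).2 mulrN.
    by rewrite (le_trans (sG.2 _ _ a0))// ler_wpM2l.
have PK k s : K k s -> 0 <= h * rowmax k + s.
  move=> [w -> ws]; apply: le_trans (_ : h * rowmax (- \row_i N i w) + G w <= _);
    last by rewrite lerD2l.
  (* If the maximum M is negative, the vector - w / M is feasible. *)
  have [M0|M0] := leP 0 (rowmax (- \row_i N i w)).
    by rewrite addr_ge0// mulr_ge0.
  set M := rowmax _ in M0 *; rewrite -oppr_gt0 in M0.
  have : h <= G ((- M)^-1 *: w).
    apply: hG => i; rewrite (lN i).2 ler_pdivlMl// mulr1 lerNl.
    by have := rowmax_ge (- \row_i N i w) i; rewrite !mxE.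
  move=> /le_trans /(_ (sG.2 _ _ _)); rewrite invr_ge0 (ltW M0) => /(_ isT).
  by rewrite ler_pdivlMl// mulNr -subr_ge0 opprK addrC mulrC.
have [f [lf fP fK]] := hahn_banach_cone (sublinear_rowmax n h0) wK PK.
have fE r : f r = \sum_i f (delta_mx 0 i) * r 0 i.
  rewrite [in LHS](row_sum_delta r) linear_suml//.
  by apply: eq_bigr => i _; rewrite lf.2 mulrC.
exists (fun i => f (delta_mx 0 i)); split=> [i||w].
- have : f (- delta_mx 0 i) <= 0.
    apply: le_trans (fP _) _; rewrite mulr_ge0_le0//.
    by apply: rowmax_le => j; rewrite !mxE eqxx oppr_le0 ler0n.
  by rewrite -scaleN1r lf.2 mulN1r oppr_le0.
- have fc (c : R) : \sum_i f (delta_mx 0 i) * c <= h * c.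
    have := fP (const_mx c); rewrite fE.
    under eq_bigr do rewrite mxE.
    move=> /le_trans; apply; rewrite ler_wpM2l//.
    by apply: rowmax_le => j; rewrite mxE.
  apply/eqP; rewrite eq_le -[leLHS]mulr1 -[leRHS]mulr1 mulr_suml fc/=.
  by have := fc (- 1); rewrite -mulr_suml !mulrN !mulr1 lerN2.
- have /fK : K (- \row_i N i w) (G w) by exists w.
  rewrite -scaleN1r lf.2 mulN1r addrC subr_ge0 fE.
  by under eq_bigr do rewrite mxE.
Qed.

End Multipliers.

(** * Dual pairings and smooth outer regions *)
Section Pairing.
Context {R : realType}.

(** Norms are approached, not attained: a functional need not attain its norm
    on the unit ball. *)
Definition dual_pairing (X Y : normedModType R) (B : X -> Y -> R) :=
  [/\ (forall y, is_linear (B^~ y)) /\ (forall x, is_linear (B x)),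
      forall x y, B x y <= `|x| * `|y|,
      forall x c, c < `|x| -> exists2 y, `|y| <= 1 & c < B x y &
      forall y c, c < `|y| -> exists2 x, `|x| <= 1 & c < B x y].

Lemma dual_pairing_sym (X Y : normedModType R) (B : X -> Y -> R) :
  dual_pairing B -> dual_pairing (fun y x => B x y).
Proof.
by move=> [[lX lY] Ble BX BY]; split=> // y x; rewrite mulrC.
Qed.

(** The signed distance from t to the interval [-r, r].  Its square is a convex
    function of class C^1 with derivative 2 * soft_threshold r, which is
    2-Lipschitz; the two inequalities below are the corresponding first and
    second order bounds. *)
Definition soft_threshold (r t : R) : R :=
  if r < t then t - r else if t < - r then t + r else 0.

Lemma soft_threshold_eq0 r t : `|t| <= r -> soft_threshold r t = 0.
Proof.
rewrite ler_norml => /andP[t1 t2]; rewrite /soft_threshold.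
by rewrite ltNge t2 ltNge t1.
Qed.

Lemma soft_thresholdN r t : 0 <= r ->
  soft_threshold r (- t) = - soft_threshold r t.
Proof.
move=> r0; rewrite /soft_threshold.
by case: (ltP r t); case: (ltP t (- r)); case: (ltP r (- t)); case: (ltP (- t) (- r)) => *; lra.
Qed.

Lemma soft_threshold_sqr_convex r s t : 0 <= r ->
  soft_threshold r t ^+ 2 + 2 * (soft_threshold r t * (s - t))
  <= soft_threshold r s ^+ 2.
Proof.
move=> r0; rewrite /soft_threshold.
have h1 := sqr_ge0 (s - t).
have h2 := sqr_ge0 (s - t + 2 * r); have h3 := sqr_ge0 (s - t - 2 * r).
by case: (ltP r t); case: (ltP t (- r)); case: (ltP r s); case: (ltP s (- r)) => *; nra.
Qed.

Lemma soft_threshold_sqr_smooth r s t : 0 <= r ->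
  soft_threshold r s ^+ 2 <=
  soft_threshold r t ^+ 2 + 2 * (soft_threshold r t * (s - t)) + (s - t) ^+ 2.
Proof.
move=> r0; rewrite /soft_threshold.
have h1 := sqr_ge0 (s - t).
have h2 := sqr_ge0 (s - t + 2 * r); have h3 := sqr_ge0 (s - t - 2 * r).
by case: (ltP r t); case: (ltP t (- r)); case: (ltP r s); case: (ltP s (- r)) => *; nra.
Qed.

Lemma soft_threshold_sqr_le r t : 0 <= r ->
  soft_threshold r t ^+ 2 <= soft_threshold r t * t.
Proof.
move=> r0; rewrite /soft_threshold.
by case: (ltP r t); case: (ltP t (- r)) => *; nra.
Qed.

End Pairing.

Section OuterRegion.
Context {R : realType} {X Y : normedModType R} (B : X -> Y -> R).
Context (pB : dual_pairing B).

Let BDl x x' y : B (x + x') y = B x y + B x' y. Proof. by case: pB => -[/(_ y)[]]. Qed.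
Let BZl a x y : B (a *: x) y = a * B x y. Proof. by case: pB => -[/(_ y)[]]. Qed.
Let BZr a x y : B x (a *: y) = a * B x y. Proof. by case: pB => -[_ /(_ x)[]]. Qed.
Let BNl x y : B (- x) y = - B x y. Proof. by rewrite -scaleN1r BZl mulN1r. Qed.

Let normB x y : `|B x y| <= `|x| * `|y|.
Proof.
case: pB => _ Ble _ _; rewrite ler_norml Ble andbT.
by have := Ble (- x) y; rewrite BNl normrN lerNl.
Qed.

(** The model is the complement of a symmetric convex body with boundary of
    curvature controlled by C.  The half space 1 <= B y n replaces U near x: it
    lies in U, the points y of U miss it by at most C |y - x|^2, and it contains
    x, as the case y = x shows.  The bound on |n| keeps it away from the open
    ball of radius r. *)
Definition smooth_outer (U : X -> Prop) r C :=
  (forall x, U x -> U (- x)) /\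
  forall x, U x -> exists n, [/\ forall y, 1 <= B y n -> U y,
    forall y, U y -> 1 - C * `|y - x| ^+ 2 <= B y n & `|n| <= r^-1].

(** U is the set where F x, the sum of the squares of the soft thresholds of the
    B x f, is at least k = (1 - r)^2.  Convexity of F bounds it below by its
    tangent, whose superlevel set {k <= tangent} is the half space 1 <= B y n
    after division by c; smoothness bounds F above by the tangent plus a
    quadratic error.  On the ball of radius r all thresholds vanish, so n cannot
    take the value 1 there. *)
Lemma smooth_outer_region (phi : seq Y) r : 0 < r -> r < 1 ->
  {in phi, forall f, `|f| <= 1} ->
  exists U C, [/\ smooth_outer U r C, 0 <= C &
    forall x f, f \in phi -> 1 <= B x f -> U x].
Proof.
move=> r0 r1 phi1.
pose s t := soft_threshold r t.
pose F x := \sum_(f <- phi) s (B x f) ^+ 2.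
pose k := (1 - r) ^+ 2.
have k0 : 0 < k by rewrite exprn_gt0// subr_gt0.
pose D x y := 2 * \sum_(f <- phi) s (B x f) * B y f.
have DB x y z : D x (y - z) = D x y - D x z.
  rewrite /D -mulrBr; congr (_ * _); rewrite -sumrB; apply: eq_bigr => f _.
  by rewrite BDl BNl mulrBr.
have FD x y : F x + D x (y - x) <= F y.
  rewrite /F /D mulr_sumr -big_split/=; apply: ler_sum => f _.
  by rewrite BDl BNl soft_threshold_sqr_convex// ltW.
have DF x y : F y <= F x + D x (y - x) + (size phi)%:R * `|y - x| ^+ 2.
  rewrite /F /D mulr_sumr -big_split/= -sum1_size natr_sum mulr_suml -big_split/=.
  rewrite big_seq [leRHS]big_seq; apply: ler_sum => f fphi.
  rewrite mul1r BDl BNl.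
  apply: le_trans (soft_threshold_sqr_smooth _ (B x f) (ltW r0)) _.
  rewrite lerD2l -BNl -BDl -real_normK ?num_real// lerXn2r ?nnegrE//.
  by rewrite (le_trans (normB _ _))// ler_piMr// phi1.
have F_le x : 2 * F x <= D x x.
  rewrite /D ler_wpM2l//; apply: ler_sum => f _.
  by rewrite soft_threshold_sqr_le// ltW.
exists (fun x => k <= F x), ((size phi)%:R / k); split.
- split=> [x|x Ux].
    move=> /le_trans; apply; rewrite /F le_eqVlt; apply/predU1P; left.
    by apply: eq_bigr => f _; rewrite BNl /s soft_thresholdN ?ltW// sqrrN.
  pose c := k - F x + D x x.
  have c0 : k <= c by rewrite /c; have := F_le x; lra.
  have {}c0' : 0 < c by exact: lt_le_trans c0.
  pose n := (c^-1 * 2) *: \sum_(f <- phi) s (B x f) *: f.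
  have Bn y : B y n = D x y / c.
    have lB : is_linear (B y) by case: pB => -[_ +].
    rewrite BZr linear_suml// /D [RHS]mulrC mulrA.
    by under eq_bigr do rewrite BZr.
  have nU y : 1 <= B y n -> k <= F y.
    rewrite Bn ler_pdivlMr// mul1r => cD.
    by apply: le_trans (FD x y); rewrite DB; move: cD; rewrite /c; lra.
  exists n; split=> // [y Uy|].
    rewrite Bn ler_pdivlMr//; have := DF x y; rewrite DB.
    move=> /(le_trans Uy) H.
    have : (size phi)%:R * `|y - x| ^+ 2 <=
        (size phi)%:R / k * `|y - x| ^+ 2 * c.
      have : 0 <= `|y - x| ^+ 2 by exact: exprn_ge0.
      move: (_ ^+ 2) => w w0; rewrite -!mulrA ler_wpM2l// mulrCA ler_peMr//.
      by rewrite ler_pdivlMl// mulr1.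
    by move: H; rewrite /c; lra.
  rewrite leNgt; apply/negP => rn; case: (pB) => _ _ _ /(_ _ _ rn)[y y1].
  rewrite -[r^-1]mulr1 ltr_pdivrMl// -BZl => /ltW/nU.
  apply/negP; rewrite -ltNge [ltLHS](_ : _ = 0)// /F big_seq big1// => f fphi.
  rewrite /s soft_threshold_eq0 ?expr0n//.
  rewrite (le_trans (normB _ _))// normrZ gtr0_norm// -mulrA ler_piMr ?(ltW r0)//.
  by rewrite mulr_ile1// phi1.
- by rewrite divr_ge0 ?(ltW k0).
- move=> x f fphi xf; rewrite /F (big_rem f)//=.
  apply: (@le_trans _ _ (s (B x f) ^+ 2)).
    rewrite /k /s /soft_threshold (lt_le_trans r1 xf).
    by rewrite lerXn2r ?nnegrE ?subr_ge0 ?(ltW r1)// ?lerD2r// (le_trans (ltW r1)).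
  by rewrite lerDl; apply: sumr_ge0 => g _; exact: sqr_ge0.
Qed.

End OuterRegion.

(** * Duality for antiperiodic polygons *)
Section AntiperiodicPolygon.
Context {R : realType} {V : lmodType R} {n : nat}.
Implicit Types v : 'I_n -> V.

(** The polygon with edges v_0, ..., v_(n-1) whose end point is the opposite of
    its starting point.  Such a polygon is determined by its edges, which are
    arbitrary, so that edges are linear coordinates on these polygons. *)
Definition vertex v (k : nat) : V :=
  2^-1 *: \sum_(j < n) (if (j < k)%N then v j else - v j).

Lemma vertex_antiperiodic v : vertex v n = - vertex v 0%N.
Proof.
rewrite /vertex -scalerN -sumrN; congr (_ *: _).
by apply: eq_bigr => j _; rewrite ltn_ord/= opprK.
Qed.

Lemma vertex_edge v (k : 'I_n) : vertex v k.+1 - vertex v k = v k.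
Proof.
rewrite /vertex -scalerBr -sumrB (bigD1 k)//= ltnS leqnn ltnn opprK.
rewrite big1 ?addr0 => [|j jk].
  by rewrite -[v k + v k]mulr2n -[v k *+ 2]scaler_nat scalerA mulVf ?scale1r.
by rewrite ltnS [in X in X - _]leq_eqVlt val_eqE (negPf jk)/= subrr.
Qed.

Lemma vertex_of_edges (p : nat -> V) : p n = - p 0%N ->
  forall k, (k <= n)%N -> vertex (fun j : 'I_n => p j.+1 - p j) k = p k.
Proof.
move=> pn; elim=> [_|k IH kn].
  rewrite /vertex (eq_bigr (fun j : 'I_n => - (p j.+1 - p j)))//.
  rewrite sumrN -(big_mkord xpredT (fun j => p j.+1 - p j)) telescope_sumr//.
  rewrite pn -opprD opprK -mulr2n -[p 0%N *+ 2]scaler_nat scalerA mulVf//.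
  by rewrite scale1r.
have := vertex_edge (fun j : 'I_n => p j.+1 - p j) (Ordinal kn).
by rewrite /= IH 1?ltnW// => /eqP; rewrite subr_eq subrK => /eqP.
Qed.

End AntiperiodicPolygon.

Section DiscreteDuality.
Context {R : realType} {X Y : normedModType R} (B : X -> Y -> R).
Context (pB : dual_pairing B).

Let lBl y : is_linear (B^~ y). Proof. by case: pB => -[]. Qed.
Let lBr x : is_linear (B x). Proof. by case: pB => -[]. Qed.

(** Summation by parts: with edges as coordinates, both sides are the sum of
    the (plus or minus) B (v j) (w i) / 2, with sign plus when j <= i. *)
Lemma vertex_duality n (v : 'I_n -> X) (w : 'I_n -> Y) :
  \sum_(i < n) B (vertex v i.+1) (w i) = \sum_(j < n) B (v j) (- vertex w j).
Proof.
have E (i : 'I_n) : B (vertex v i.+1) (w i) =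
    \sum_(j < n) 2^-1 * (if (j < i.+1)%N then B (v j) (w i) else - B (v j) (w i)).
  rewrite /vertex (lBl _).2 (linear_suml _ _ (lBl _)) mulr_sumr.
  apply: eq_bigr => j _; case: ifP => // _.
  by rewrite -scaleN1r (lBl _).2 mulN1r.
have F (j : 'I_n) : B (v j) (- vertex w j) =
    \sum_(i < n) 2^-1 * (if (j < i.+1)%N then B (v j) (w i) else - B (v j) (w i)).
  rewrite /vertex -scalerN (lBr _).2 -sumrN (linear_suml _ _ (lBr _)) mulr_sumr.
  apply: eq_bigr => i _; rewrite ltnS ltnNge; case: leqP => //= _.
    by rewrite opprK.
  by rewrite -scaleN1r (lBr _).2 mulN1r.
under eq_bigr do rewrite E; rewrite exchange_big/=.
by apply: eq_bigr => j _; rewrite F.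
Qed.

Definition maxnorm n (v : {ffun 'I_n -> X}) := \big[Num.max/0]_j `|v j|.

Lemma maxnorm_ge n (v : {ffun 'I_n -> X}) j : `|v j| <= maxnorm v.
Proof. exact: le_bigmax. Qed.

Lemma maxnorm_le n (v : {ffun 'I_n -> X}) M : 0 <= M ->
  (forall j, `|v j| <= M) -> maxnorm v <= M.
Proof. by move=> M0 vM; apply: bigmax_le. Qed.

Lemma maxnorm_ge0 n (v : {ffun 'I_n -> X}) : 0 <= maxnorm v.
Proof. exact: bigmax_ge_id. Qed.

Lemma sublinear_maxnorm n : sublinear (@maxnorm n).
Proof.
split=> [v w|a v a0]; apply: maxnorm_le => [|j].
- by rewrite addr_ge0 ?maxnorm_ge0.
- by rewrite ffunE (le_trans (ler_normD _ _))// lerD ?maxnorm_ge.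
- by rewrite mulr_ge0 ?maxnorm_ge0.
- by rewrite ffunE normrZ ger0_norm// ler_wpM2l ?maxnorm_ge.
Qed.

Lemma vertex_linear n k :
  (forall v w : {ffun 'I_n -> X}, vertex (v + w) k = vertex v k + vertex w k) /\
  (forall a (v : {ffun 'I_n -> X}), vertex (a *: v) k = a *: vertex v k).
Proof.
split=> [v w|a v]; rewrite /vertex.
  rewrite -scalerDr -big_split/=; congr (_ *: _); apply: eq_bigr => j _.
  by rewrite ffunE; case: ifP; rewrite // opprD.
rewrite scalerA mulrC -scalerA; congr (_ *: _); rewrite scaler_sumr.
by apply: eq_bigr => j _; rewrite ffunE; case: ifP; rewrite // scalerN.
Qed.

(** Here h' is the infimum of the longest edge over the polygons with vertices
    in U, h = h' + eta is reached by v, and N i is the normal at the vertex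
    i + 1.  The multipliers m of the linearised problem give Z.  The numbers
    d k bound the loss of norm along the edge k of Z; up to t they come from
    a k, the excess in the constraint at the vertex k + 1 (of total weight at
    most eta by complementary slackness), and from the quadratic error C h^2. *)
Theorem discrete_duality (U : X -> Prop) r C n (h0 eta : R)
    (v0 : 'I_n.+1 -> X) : smooth_outer B U r C -> 0 < r -> 0 <= C -> 0 < eta ->
  (forall j, `|v0 j| <= h0) -> (forall i : 'I_n.+1, U (vertex v0 i.+1)) ->
  exists (Z : nat -> Y) (d : 'I_n.+1 -> R), [/\ Z n.+1 = - Z 0%N,
    \sum_(k < n.+1) `|Z k.+1 - Z k| <= h0 / r,
    (forall k, 0 <= d k) /\
    \sum_k d k <= C * (h0 + eta) ^+ 2 + n.+2%:R * (eta * n.+1%:R / (2 * r)),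
    forall (k : 'I_n.+1) s, 0 <= s <= 1 ->
      `|Z k| - d k <= `|(1 - s) *: Z k + s *: Z k.+1| &
    1 - eta * n.+1%:R / (2 * r) <= \sum_(k < n.+1) `|Z k|].
Proof.
move=> [UN Un] r0 C0 eta0 v0h Uv0.
pose H := [set h | exists v : {ffun 'I_n.+1 -> X},
  (forall j, `|v j| <= h) /\ forall i : 'I_n.+1, U (vertex v i.+1)].
have Hh0 : H h0.
  exists [ffun j => v0 j]; split=> [j|i]; first by rewrite ffunE.
  by rewrite /vertex; under eq_bigr do rewrite ffunE; exact: Uv0.
have Hge0 h : H h -> 0 <= h.
  by move=> [v [vh _]]; exact: le_trans (vh ord0).
have Hinf : has_inf H by split; [exists h0 | exists 0 => h /Hge0].
pose h' := inf H; have h'0 : 0 <= h' by apply: lb_le_inf; [exists h0 | exact: Hge0].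
have h'h0 : h' <= h0 by apply: ge_inf => //; exact: Hinf.2.
pose h := h' + eta; have h_gt0 : 0 < h by rewrite ltr_wpDl.
have [v [vh Uv]] : H h.
  have [h1 [v [vh1 Uv]] h1h] := inf_adherent eta0 Hinf.
  by exists v; split=> // j; rewrite (le_trans (vh1 j))// ltW.
have /choice[N HN] : forall i : 'I_n.+1, exists m,
    [/\ forall y, 1 <= B y m -> U y,
        forall y, U y -> 1 - C * `|y - vertex v i.+1| ^+ 2 <= B y m &
        `|m| <= r^-1].
  by move=> i; exact: Un.
have BV a x y : B (a *: x) y = a * B x y by rewrite (lBl _).2.
have BN x y : B (- x) y = - B x y by rewrite -scaleN1r BV mulN1r.
have Ble x y : B x y <= `|x| * `|y| by case: pB.
have [|i|w Nw|m [m0 mh' mG]] := @lagrange_multipliers _ {ffun 'I_n.+1 -> X} n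
  (@maxnorm n.+1) (fun i w => B (vertex w i.+1) (N i)) h' (@sublinear_maxnorm _) _ _ h'0.
- by move=> ?; exact: maxnorm_ge0.
- have [vD vZ] := vertex_linear n.+1 i.+1.
  by split=> [w w'|a w]; rewrite ?vD ?vZ ?(lBl _).1 ?(lBl _).2.
- apply: ge_inf; first exact: Hinf.2.
  exists w; split=> [j|i]; first exact: maxnorm_ge.
  by have [NU _ _] := HN i; exact: NU.
pose Z k := - vertex (fun i => m i *: N i) k.
have dual (w : {ffun 'I_n.+1 -> X}) :
    \sum_(i < n.+1) m i * B (vertex w i.+1) (N i) = \sum_(j < n.+1) B (w j) (Z j).
  by rewrite -vertex_duality; apply: eq_bigr => i _; rewrite (lBr _).2.
have Z1 (w : {ffun 'I_n.+1 -> X}) :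
    (forall j, `|w j| <= 1) -> \sum_(j < n.+1) B (w j) (Z j) <= 1.
  by move=> w1; rewrite -dual (le_trans (mG w))// maxnorm_le.
have dZ (k : 'I_n.+1) : Z k.+1 - Z k = - (m k *: N k).
  by rewrite -opprD -[in RHS](vertex_edge (fun i => m i *: N i) k).
pose a (i : 'I_n.+1) := B (vertex v i.+1) (N i) - 1.
have a0 (i : 'I_n.+1) : 0 <= a i.
  have [_ /(_ _ (Uv i))] := HN i.
  by rewrite subrr normr0 expr0n/= mulr0 subr0 subr_ge0.
pose u : {ffun 'I_n.+1 -> X} := h^-1 *: v.
have u1 j : `|u j| <= 1.
  by rewrite ffunE normrZ gtr0_norm ?invr_gt0// ler_pdivrMl// mulr1.
pose b (j : 'I_n.+1) := B (u j) (Z j).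
have sumb : \sum_j b j = h^-1 * (h' + \sum_i m i * a i).
  rewrite -mh' -big_split/= [X in _ * X](_ : _ =
    \sum_(i < n.+1) m i * B (vertex v i.+1) (N i)); last first.
    by apply: eq_bigr => i _; rewrite /a mulrBr mulr1 addrC subrK.
  rewrite dual mulr_sumr; apply: eq_bigr => j _.
  by rewrite /b ffunE BV.
have ma0 : 0 <= \sum_i m i * a i by apply: sumr_ge0 => i _; exact: mulr_ge0.
(* Complementary slackness, up to eta. *)
have ma : \sum_i m i * a i <= eta.
  have := Z1 u u1; rewrite sumb ler_pdivrMl// mulr1 /h; lra.
pose t := eta * n.+1%:R / (2 * r).
(* The end vertex has norm at least r and is opposite to the starting one, so
   the edges, of length at most h, have total length at least 2 r. *)
have eta_t : eta / h <= t.
  rewrite /t -mulrA ler_pM2l// ler_pdivlMr ?mulr_gt0// ler_pdivrMl//.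
  have [_ _ Nr] := HN ord_max.
  have := Ble (vertex v n.+1) (N ord_max).
  have := a0 ord_max; rewrite subr_ge0 => /le_trans /[apply] rv.
  have {}rv : r <= `|vertex v n.+1|.
    rewrite -[leLHS]mulr1 -ler_pdivlMl// mulrC (le_trans rv)//.
    by rewrite ler_wpM2l.
  have -> : h * n.+1%:R = \sum_(j < n.+1) h.
    by rewrite sumr_const card_ord mulr_natr.
  apply: le_trans (_ : 2 * `|vertex v n.+1| <= _); first by rewrite ler_pM2l.
  rewrite -[2]gtr0_norm// -normrZ /vertex scalerA mulfV// scale1r.
  rewrite (le_trans (ler_norm_sum _ _ _))// ler_sum// => j _.
  by rewrite ltn_ord.
have sumb_ge : 1 - t <= \sum_j b j.
  rewrite sumb; apply: le_trans (_ : h^-1 * h' <= _); last first.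
    by rewrite ler_pM2l ?invr_gt0// lerDl.
  have -> : h^-1 * h' = 1 - eta / h.
    by rewrite -[h'](addrK eta) -/h mulrBr mulVf ?gt_eqF// mulrC.
  by rewrite lerD2l lerN2.
(* Replacing the j-th edge direction by any unit vector x cannot raise the sum
   of the b j above 1, so B x (Z j) cannot exceed b j by more than t. *)
have Zb (j : 'I_n.+1) : `|Z j| <= b j + t.
  rewrite leNgt; apply/negP => bZ; case: (pB) => _ _ _ /(_ _ _ bZ)[x x1].
  apply/negP; rewrite -leNgt.
  pose w := [ffun i => if i == j then x else u i].
  have /Z1 : forall i, `|w i| <= 1 by move=> i; rewrite ffunE; case: ifP.
  rewrite (bigD1 j)//= ffunE eqxx => wZ.
  rewrite (eq_bigr b) in wZ; last by move=> i ij; rewrite ffunE (negPf ij).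
  by move: sumb_ge; rewrite (bigD1 j)//= ; lra.
have bZ (j : 'I_n.+1) : b j <= `|Z j|.
  by rewrite (le_trans (Ble _ _))// ler_piMl.
pose d (k : 'I_n.+1) := t + m k * (a k / h + C * h).
(* The vertex k lies in U, so the normal at the vertex k + 1 almost vanishes on
   the edge between them.  For k = 0 this vertex is the opposite of the last. *)
have uN (k : 'I_n.+1) : B (u k) (N k) <= a k / h + C * h.
  have Uk : U (vertex v k).
    case: (unliftP ord0 k) => [i ->|->]; first exact: (Uv (widen_ord (leqnSn n) i)).
    by rewrite -[vertex v _]opprK -vertex_antiperiodic; exact: UN (Uv ord_max).
  have [_ /(_ _ Uk) + _] := HN k.
  have -> : vertex v k = vertex v k.+1 - v k.
    by rewrite -[v k in RHS](vertex_edge v) subKr.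
  rewrite addrAC subrr add0r normrN (lBl _).1 BN => H1.
  have H2 : C * `|v k| ^+ 2 <= C * h ^+ 2.
    by rewrite ler_wpM2l// lerXn2r ?nnegrE// ltW.
  rewrite ffunE BV ler_pdivrMl// mulrDr mulrCA mulfV ?gt_eqF// mulr1.
  by move: H2; rewrite expr2 /a mulrCA => H2; lra.
have t0 : 0 <= t by rewrite /t !mulr_ge0 ?invr_ge0 ?mulr_ge0 ?ltW.
have d0 k : 0 <= d k.
  by rewrite addr_ge0// mulr_ge0// addr_ge0 ?mulr_ge0 ?invr_ge0// ltW.
exists Z, d; split.
- by rewrite /Z vertex_antiperiodic.
- rewrite (eq_bigr (fun k => m k * `|N k|)); last first.
    by move=> k _; rewrite dZ normrN normrZ ger0_norm.
  apply: le_trans (_ : \sum_k m k / r <= _).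
    by apply: ler_sum => k _; rewrite ler_wpM2l//; have [] := HN k.
  by rewrite -mulr_suml mh' ler_pM2r ?invr_gt0.
- split=> //; rewrite /d big_split/= sumr_const card_ord -/t.
  have -> : \sum_i m i * (a i / h + C * h) =
      (\sum_i m i * a i) / h + h' * (C * h).
    rewrite -mh' !mulr_suml -big_split; apply: eq_bigr => i _.
    by rewrite mulrDr mulrA.
  have H1 : (\sum_i m i * a i) / h <= t.
    by apply: le_trans eta_t; rewrite ler_pM2r ?invr_gt0.
  have H2 : h' * (C * h) <= C * (h0 + eta) ^+ 2.
    rewrite mulrCA ler_wpM2l// expr2 ler_pM//; first exact: ltW.
      by rewrite (le_trans h'h0)// lerDl ltW.
    by rewrite lerD2r.
  rewrite -[_ *+ n.+1]mulr_natl -[n.+2]addn1 natrD mulrDl mul1r.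
  lra.
- move=> k s /andP[s0 s1].
  have -> : (1 - s) *: Z k + s *: Z k.+1 = Z k - s *: (m k *: N k).
    by rewrite -scalerN -dZ scalerBl scale1r scalerBr addrAC -addrA.
  apply: le_trans (_ : B (u k) (Z k - s *: (m k *: N k)) <= _); last first.
    by rewrite (le_trans (Ble _ _))// ler_piMl.
  rewrite (lBr _).1 -[- (s *: _)]scaleN1r !(lBr _).2 mulN1r -/(b k) /d.
  have H1 : s * (m k * B (u k) (N k)) <= m k * (a k / h + C * h).
    apply: le_trans (_ : s * (m k * (a k / h + C * h)) <= _).
      by rewrite !ler_wpM2l.
    rewrite ler_piMl// mulr_ge0// addr_ge0 ?mulr_ge0 ?invr_ge0// ltW//.
  by have := Zb k; lra.
- rewrite -/t (le_trans sumb_ge)//; apply: ler_sum => k _; exact: bZ.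
Qed.

End DiscreteDuality.

(** * Arcs and radial projection *)
Section Arcs.
Context {R : realType} {V : normedModType R}.
Implicit Types (S : V -> Prop) (a b : V) (l : R).

(** Curves are handled as 1-Lipschitz maps on [0, l]: continuity and the bound
    on the length come for free, and concatenation is immediate. *)
Definition arc S l a b := exists g : R -> V,
  [/\ 0 <= l, g 0 = a, g l = b,
      forall s t, 0 <= s -> s <= t -> t <= l -> `|g t - g s| <= t - s &
      forall t, 0 <= t -> t <= l -> S (g t)].

Lemma arc0 S a : S a -> arc S 0 a a.
Proof.
move=> Sa; exists (fun=> a); split=> // s t _ st _.
by rewrite subrr normr0 subr_ge0.
Qed.

Lemma arc_cat S l l' a b d : arc S l a b -> arc S l' b d -> arc S (l + l') a d.
Proof.
move=> [g [l0 ga gb gL gS]] [g' [l'0 gb' gd gL' gS']].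
exists (fun t => if t <= l then g t else g' (t - l)); split.
- exact: addr_ge0.
- by rewrite l0.
- case: leP => [|_]; last by rewrite addrC addKr.
  rewrite gerDl => l'_le0; rewrite -gd (_ : l' = 0) ?addr0 ?gb ?gb'//.
  by apply/le_anti; rewrite l'_le0.
- move=> s t s0 st tl; case: (leP t l) => [tl'|lt].
    by rewrite (le_trans st tl') gL.
  case: (leP s l) => [sl|ls]; last first.
    by rewrite (le_trans (gL' _ _ _ _ _)) ?subr_ge0 ?(ltW ls) ?lerD2r ?lerBlDl//; lra.
  rewrite -[g' _](subrK b) -addrA (le_trans (ler_normD _ _))//.
  have H1 : `|b - g s| <= l - s by rewrite -gb gL.
  have H2 : `|g' (t - l) - b| <= t - l - 0.
    by rewrite -gb' gL'//; lra.
  lra.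
- move=> t t0 tl; case: (leP t l) => [tl'|lt]; first exact: gS.
  by apply: gS'; lra.
Qed.

Lemma arc_le S l l' a b : l <= l' -> arc S l a b -> arc S l' a b.
Proof.
move=> ll' [g [l0 ga gb gL gS]].
exists (fun t => g (Num.min t l)); split=> //.
- exact: le_trans ll'.
- by rewrite min_l.
- by rewrite min_r.
- move=> s t s0 st _; rewrite (le_trans (gL _ _ _ _ _))//.
  + by rewrite le_min s0.
  + by rewrite le_min !ge_min st lexx orbT.
  + by rewrite ge_min lexx orbT.
  + by case: (leP t l) => ?; case: (leP s l) => ?; lra.
- by move=> t t0 _; apply: gS; rewrite ?le_min ?t0// ge_min lexx orbT.
Qed.

Lemma arc_rev S l a b : arc S l a b -> arc S l b a.
Proof.
move=> [g [l0 ga gb gL gS]]; exists (fun t => g (l - t)); split=> //.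
- by rewrite subr0.
- by rewrite subrr.
- move=> s t s0 st tl; rewrite distrC (le_trans (gL _ _ _ _ _)) ?subr_ge0//.
  + by rewrite lerD2l lerN2.
  + by rewrite gerBl.
  + by lra.
- by move=> t t0 tl; apply: gS; rewrite ?subr_ge0// gerBl.
Qed.

Lemma arc_sum S (l : nat -> R) (p : nat -> V) n : S (p 0%N) ->
  (forall k, (k < n)%N -> arc S (l k) (p k) (p k.+1)) ->
  arc S (\sum_(0 <= k < n) l k) (p 0%N) (p n).
Proof.
move=> S0; elim: n => [_|n IH ln]; first by rewrite big_geq//; exact: arc0.
rewrite big_nat_recr//=; apply: arc_cat (ln n _) => //.
by apply: IH => k kn; apply: ln; exact: ltnW.
Qed.

(** Reparametrisation by arc length: c is composed with a right inverse of A
    chosen by the intermediate value theorem.  Where A is constant so is c, so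
    the choice does not matter. *)
Lemma arc_reparam S (c : R -> V) (A : R -> R) :
  {within `[0, 1], continuous A} ->
  (forall s t, 0 <= s -> s <= t -> t <= 1 -> `|c t - c s| <= A t - A s) ->
  (forall t, 0 <= t -> t <= 1 -> S (c t)) ->
  arc S (A 1 - A 0) (c 0) (c 1).
Proof.
move=> Ac cA cS.
have A01 : A 0 <= A 1.
  by rewrite -subr_ge0; apply: le_trans (cA 0 1 _ _ _).
have /choice[s sP] : forall t, exists s, 0 <= t -> t <= A 1 - A 0 ->
    [/\ 0 <= s, s <= 1 & A s = A 0 + t].
  move=> t; have [[t0 tl]|] := pselect (0 <= t /\ t <= A 1 - A 0); last first.
    by move=> nt; exists 0 => t0 tl; case: nt.
  have [] := IVT (@ler01 R) Ac (v := A 0 + t).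
    by rewrite min_l// max_r//; apply/andP; split; lra.
  by move=> s; rewrite in_itv/= => /andP[s0 s1] As; exists s.
have c_eq x y : 0 <= x -> x <= y -> y <= 1 -> A x = A y -> c x = c y.
  move=> x0 xy y1 Axy; apply/esym/eqP; rewrite -subr_eq0 -normr_le0.
  by rewrite (le_trans (cA x y _ _ _))// Axy subrr.
have l0 : 0 <= A 1 - A 0 by rewrite subr_ge0.
exists (c \o s) => /=; split=> //.
- have [s0 s1 As] := sP 0 (lexx 0) l0.
  by apply/esym/c_eq => //; rewrite As addr0.
- have [s0 s1 As] := sP _ l0 (lexx _).
  by apply: c_eq => //; rewrite As addrC subrK.
- move=> x y x0 xy yl.
  have [|sx0 sx1 Asx] := sP x x0 _; first exact: le_trans yl.
  have [|sy0 sy1 Asy] := sP y _ yl; first exact: le_trans xy.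
  have [sxy|syx] := leP (s x) (s y).
    by rewrite (le_trans (cA _ _ _ sxy _))// Asx Asy; lra.
  rewrite distrC (le_trans (cA _ _ _ (ltW syx) _))// Asx Asy.
  by have := cA _ _ sy0 (ltW syx) sx1; rewrite Asx Asy => /(le_trans (normr_ge0 _)); lra.
- by move=> t t0 tl; have [s0 s1 _] := sP t t0 tl; exact: cS.
Qed.

Definition segment a b (s : R) := (1 - s) *: a + s *: b.

Lemma segment0 a b : segment a b 0 = a.
Proof. by rewrite /segment subr0 scale1r scale0r addr0. Qed.

Lemma segment1 a b : segment a b 1 = b.
Proof. by rewrite /segment subrr scale1r scale0r add0r. Qed.

Lemma segmentE a b s : segment a b s = a + s *: (b - a).
Proof. by rewrite /segment scalerBl scale1r scalerBr addrAC -addrA. Qed.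

Lemma segmentB a b s t : segment a b t - segment a b s = (t - s) *: (b - a).
Proof. by rewrite !segmentE opprD addrACA subrr add0r -scalerBl. Qed.

Lemma continuous_segment a b : continuous (segment a b).
Proof.
move=> s; apply: cvgD; apply: cvgZr_tmp.
- by apply: cvgB; [exact: cvg_cst|exact: cvg_id].
- exact: cvg_id.
Qed.

Lemma segment_segment a b s t x :
  segment (segment a b s) (segment a b t) x = segment a b ((1 - x) * s + x * t).
Proof.
rewrite [LHS]/segment !segmentE; move: (b - a) => d.
by rewrite !scalerDr !scalerA addrACA -!scalerDl subrK scale1r.
Qed.

Lemma segment_norm_convex a b s t x : 0 <= x -> x <= 1 ->
  `|segment a b ((1 - x) * s + x * t)| <=
  (1 - x) * `|segment a b s| + x * `|segment a b t|.
Proof.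
move=> x0 x1.
rewrite -segment_segment [X in `|X|]/(segment _ _ x).
rewrite (le_trans (ler_normD _ _))// !normrZ.
by rewrite !ger0_norm ?subr_ge0.
Qed.

Lemma arc_segment S a b :
  (forall s, 0 <= s -> s <= 1 -> S (segment a b s)) -> arc S `|b - a| a b.
Proof.
move=> Sab; have := @arc_reparam S (segment a b) (fun s => s * `|b - a|).
rewrite /= segment0 segment1 mul1r mul0r subr0; apply => //.
  by apply: continuous_subspaceT => s; apply: cvgM; [exact: cvg_id|exact: cvg_cst].
move=> s t s0 st t1; rewrite segmentB normrZ ger0_norm ?subr_ge0//.
by rewrite mulrBl.
Qed.

(** The estimate behind radial projection; keeping the variation of the norm as a
    separate term avoids the factor 2 of the usual Lipschitz bound. *)
Lemma normalizeB_le mu a b : 0 < mu -> mu <= `|a| -> mu <= `|b| ->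
  `| `|a|^-1 *: a - `|b|^-1 *: b| <= (`|a - b| + `| `|a| - `|b| |) / mu.
Proof.
move=> mu0 mua mub.
have a0 : 0 < `|a| by exact: lt_le_trans mua.
have b0 : 0 < `|b| by exact: lt_le_trans mub.
have -> : `|a|^-1 *: a - `|b|^-1 *: b =
    `|a|^-1 *: (a - b + ((`|b| - `|a|) / `|b|) *: b).
  rewrite mulrBl mulfV ?gt_eqF// scalerBl scale1r addrA subrK scalerBr.
  by rewrite scalerA mulrA mulVf ?gt_eqF// mul1r.
rewrite normrZ gtr0_norm ?invr_gt0// mulrC.
apply: ler_pM; rewrite ?invr_ge0 ?(ltW a0)//; last by rewrite lef_pV2.
rewrite (le_trans (ler_normD _ _))// lerD2l normrZ normrM normfV normr_id.
by rewrite divfK ?gt_eqF// distrC.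
Qed.

(** Moving along a segment, the normalised point moves at most as much as the
    point plus the variation of its norm, divided by mu; a monotone norm
    has variation equal to the difference of its end values. *)
Lemma arc_normalize_noninc mu a b : 0 < mu ->
  (forall s, 0 <= s -> s <= 1 -> mu <= `|segment a b s|) ->
  (forall s t, 0 <= s -> s <= t -> t <= 1 ->
    `|segment a b t| <= `|segment a b s|) ->
  arc unit_sphere ((`|b - a| + `|a| - `|b|) / mu) (`|a|^-1 *: a) (`|b|^-1 *: b).
Proof.
move=> mu0 ge_mu noninc.
pose N s := `|segment a b s|.
pose A s := (s * `|b - a| - N s) / mu.
have := @arc_reparam unit_sphere (fun s => (N s)^-1 *: segment a b s) A.
rewrite [A 1 - A 0](_ : _ = (`|b - a| + `|a| - `|b|) / mu); last first.
  by rewrite /A /N segment0 segment1; field; rewrite gt_eqF.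
rewrite /N segment0 segment1; apply.
- apply: continuous_subspaceT => s; apply: cvgM; last exact: cvg_cst.
  apply: cvgB; first by apply: cvgM; [exact: cvg_id|exact: cvg_cst].
  by apply: cvg_norm; exact: continuous_segment.
- move=> s t s0 st t1.
  apply: le_trans (normalizeB_le mu0 _ _) _; [| |rewrite /A -mulrBl].
  + by apply: ge_mu => //; exact: le_trans st.
  + by apply: ge_mu => //; exact: le_trans t1.
  rewrite ler_pM2r ?invr_gt0// segmentB normrZ ger0_norm ?subr_ge0//.
  rewrite ler0_norm ?subr_le0 ?noninc// /N; lra.
- move=> s s0 s1; rewrite /unit_sphere/= normrZ ger0_norm ?invr_ge0// mulVf//.
  by rewrite gt_eqF// (lt_le_trans mu0)// ge_mu.
Qed.

(** A convex function on [0, 1] that is least at 1 is nonincreasing. *)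
Lemma segment_to_min a p : (forall x, 0 <= x -> x <= 1 -> `|p| <= `|segment a p x|) ->
  forall s t, 0 <= s -> s <= t -> t <= 1 -> `|segment a p t| <= `|segment a p s|.
Proof.
move=> pmin s t s0 st t1.
have [s1|s1] := ltP s 1; last first.
  by rewrite (_ : t = s)//; lra.
pose z := (t - s) / (1 - s).
have s1' : 0 < 1 - s by rewrite subr_gt0.
have z0 : 0 <= z by rewrite divr_ge0 ?subr_ge0// ltW.
have z1 : z <= 1 by rewrite ler_pdivrMr// mul1r lerD2r.
have tE : t = (1 - z) * s + z * 1 by rewrite /z; field; rewrite gt_eqF.
rewrite {1}tE (le_trans (segment_norm_convex _ _ _ _ z0 z1))// segment1.
have := pmin s s0 (ltW s1); nra.
Qed.

Lemma arc_normalize_to_min mu a p : 0 < mu -> mu <= `|p| ->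
  (forall x, 0 <= x -> x <= 1 -> `|p| <= `|segment a p x|) ->
  arc unit_sphere ((`|p - a| + `|a| - `|p|) / mu) (`|a|^-1 *: a) (`|p|^-1 *: p).
Proof.
move=> mu0 mup pmin; apply: arc_normalize_noninc => // [x x0 x1|].
  exact: le_trans (pmin x x0 x1).
exact: segment_to_min.
Qed.

(** The norm is convex along the segment, so it decreases up to a point p where
    it is least and then increases.  Both halves have monotone norm, and since
    |p| is at least |a| - d the total variation is at most |b| - |a| + 2 d. *)
Lemma arc_normalize mu d a b : 0 < mu ->
  (forall s, 0 <= s -> s <= 1 -> mu <= `|segment a b s|) ->
  (forall s, 0 <= s -> s <= 1 -> `|a| - d <= `|segment a b s|) ->
  arc unit_sphere ((`|b - a| + `|b| - `|a| + 2 * d) / mu)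
    (`|a|^-1 *: a) (`|b|^-1 *: b).
Proof.
move=> mu0 ge_mu ge_d.
pose N s := `|segment a b s|.
have cN : {within `[0, 1], continuous N}.
  by apply: continuous_subspaceT => s; apply: cvg_norm; exact: continuous_segment.
have [s + smin] := EVT_min (@ler01 R) cN.
rewrite in_itv/= => /andP[s0 s1]; set p := segment a b s.
have pmin x : 0 <= x -> x <= 1 -> `|p| <= `|segment a b x|.
  by move=> x0 x1; apply: smin; rewrite in_itv/= x0.
have pmu : mu <= `|p| by exact: ge_mu.
have ap : arc unit_sphere ((`|p - a| + `|a| - `|p|) / mu) (`|a|^-1 *: a) (`|p|^-1 *: p).
  apply: arc_normalize_to_min => // x x0 x1.
  rewrite -{1}(segment0 a b) segment_segment mulr0 add0r.
  by apply: pmin; [exact: mulr_ge0|exact: mulr_ile1].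
have bp : arc unit_sphere ((`|p - b| + `|b| - `|p|) / mu) (`|b|^-1 *: b) (`|p|^-1 *: p).
  apply: arc_normalize_to_min => // x x0 x1.
  rewrite -{1}(segment1 a b) segment_segment mulr1.
  have : 0 <= x * (1 - s) by rewrite mulr_ge0// subr_ge0.
  have : x * (1 - s) <= 1 by rewrite mulr_ile1// ?subr_ge0// gerBl.
  by move=> ? ?; apply: pmin; nra.
apply: arc_le (arc_cat ap (arc_rev bp)).
rewrite -mulrDl ler_pM2r ?invr_gt0//.
have -> : `|p - a| = s * `|b - a|.
  by have := segmentB a b 0 s; rewrite segment0 subr0 => ->; rewrite normrZ ger0_norm.
have -> : `|p - b| = (1 - s) * `|b - a|.
  have := segmentB a b s 1; rewrite segment1 distrC => ->.
  by rewrite normrZ ger0_norm ?subr_ge0.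
have := ge_d s s0 s1; rewrite -/p; lra.
Qed.

End Arcs.

(** * Inscribed polygons and closed curves *)
Section Curves.
Context {R : realType} {V : normedModType R}.
Implicit Types (c : R -> V) (s : seq R).

Lemma polygon_length_nil a b c : polygon_length a b c [::] = 0.
Proof. by rewrite /polygon_length big_geq. Qed.

Lemma polygon_length_cons a b c x s :
  polygon_length a b c (x :: s) = `|c x - c a| + polygon_length x b c s.
Proof. by rewrite /polygon_length /= big_nat_recl. Qed.

Lemma polygon_length_cat a b d c s s' :
  polygon_length a d c (s ++ s') =
  polygon_length a b c s + polygon_length (last a s) d c s'.
Proof.
elim: s a => [|x s IH] a /=; first by rewrite polygon_length_nil add0r.
by rewrite !polygon_length_cons IH addrA.
Qed.

Lemma polygon_length_lipschitz a b c s k : itv_partition a b s ->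
  (forall x y, a <= x -> x <= y -> y <= b -> `|c y - c x| <= k * (y - x)) ->
  polygon_length a b c s <= k * (b - a).
Proof.
elim: s a => [|x s IH] a.
  by move=> /itv_partition_nil -> _; rewrite polygon_length_nil subrr mulr0.
move=> /[dup] [[/= /andP[ax _] _]] /itv_partition_cons xs lip.
have xb := itv_partition_le xs.
rewrite polygon_length_cons (_ : b - a = (x - a) + (b - x)); last by lra.
rewrite mulrDr lerD//; first by apply: lip => //; exact: ltW.
by apply: IH => // y z xy; apply: lip; rewrite (le_trans (ltW ax)).
Qed.

Lemma arc_polygon (S : V -> Prop) c e a b s :
  path (fun p q => `|c q - c p| <= e) a s ->
  (forall p x, p \in a :: s -> `|x - c p| <= e -> S x) -> 0 <= e ->
  arc S (polygon_length a b c s) (c a) (c (last a s)).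
Proof.
move=> + + e0; elim: s a => [|q s IH] a /=.
  move=> _ Sx; rewrite polygon_length_nil; apply: arc0.
  by apply: (Sx a); rewrite ?mem_head// subrr normr0.
move=> /andP[aq qs] Sx; rewrite polygon_length_cons.
apply: arc_cat (IH q qs _); last first.
  by move=> p x ps; apply: Sx; rewrite inE ps orbT.
apply: arc_segment => t t0 t1; apply: (Sx a); first by rewrite mem_head.
have := segmentB (c a) (c q) 0 t; rewrite segment0 subr0 => ->.
by rewrite normrZ ger0_norm// (le_trans _ aq)// ler_piMl.
Qed.

(** Uniform continuity on the interval, from compactness in the form of a
    covering by neighbourhoods. *)
Lemma uniformly_continuous_itv c e : {within `[0, 1], continuous c} -> 0 < e ->
  exists2 d, 0 < d & forall x y, 0 <= x <= 1 -> 0 <= y <= 1 ->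
    `|y - x| <= d -> `|c y - c x| <= e.
Proof.
move=> /subspace_continuousP cc e0.
have /compact_near_coveringP K := @segment_compact R 0 1.
pose P (i x : R) := forall y, 0 <= y <= 1 -> `|y - x| <= i ->
  0 <= x <= 1 -> `|c y - c x| <= e.
have : \forall i \near (0 : R)^'+, `[0, 1] `<=` P i.
  apply: K => x x01.
  have := cc x x01 => /cvgrPdist_le /(_ (e / 2)).
  rewrite divr_gt0// => /(_ isT); rewrite near_withinE => /nbhs_ballP[r /= r0 cr].
  exists (ball x (r / 2), [set i | i < r / 2]) => /=.
    split; first by apply: nbhsx_ballx; rewrite divr_gt0.
    by apply: nbhs_right_lt; rewrite divr_gt0.
  move=> [x' i] /= [xx' ir] y y01 yx' x'01.
  have bx : ball x r x' by apply: le_ball xx'; lra.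
  have byr : ball x r y.
    move: xx'; rewrite /ball/= => xx'; rewrite -[x - y](subrK (- x')) opprK.
    rewrite (_ : x - y + x' + - x' = (x - x') + (x' - y)); last by ring.
    rewrite distrC in yx'; apply: le_lt_trans (ler_normD _ _) _.
    have : i < r / 2 by []. lra.
  have H1 : `|c x - c x'| <= e / 2 by apply: (cr x' bx); rewrite /= in_itv.
  have H2 : `|c x - c y| <= e / 2 by apply: (cr y byr); rewrite /= in_itv.
  rewrite -[c y](subrK (c x)) -addrA (le_trans (ler_normD _ _))//.
  by rewrite distrC; lra.
move=> Knear.
have [d [d0 dP]] : exists d, 0 < d /\ `[0, 1] `<=` P d.
  by near (0:R)^'+ => d; exists d; split; near: d => //; exact: nbhs_right_gt.
exists d => // x y x01 y01 xy; apply: dP => //=.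
Unshelve. all: by end_near. Qed.

Lemma fine_partition c e a b : {within `[0, 1], continuous c} -> 0 < e ->
  0 <= a -> a < b -> b <= 1 -> exists2 s, itv_partition a b s &
    path (fun p q => `|c q - c p| <= e) a s.
Proof.
move=> cc e0 a0 ab b1; have [d d0 cd] := uniformly_continuous_itv cc e0.
have [n] : exists n, b - a <= n%:R * d.
  exists (Num.Def.truncn ((b - a) / d)).+1.
  by rewrite -ler_pdivrMr// ltW// truncnS_gt.
elim: n a a0 ab => [|n IH] a a0 ab.
  by rewrite mul0r subr_le0 leNgt ab.
have [bad _|bad] := leP (b - a) d.
  exists [:: b]; first exact: itv_partition1.
  rewrite /= andbT; apply: cd; try by apply/andP; split; lra.
  by rewrite ger0_norm ?subr_ge0// ltW.
rewrite -addn1 natrD mulrDl mul1r => nd.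
have [|||s abs ps] := IH (a + d); [lra..|].
exists (a + d :: s).
  by move: abs => [? ?]; split; rewrite //= ltrDl d0.
rewrite /= ps andbT; apply: cd; try by apply/andP; split; lra.
by rewrite addrAC subrr add0r gtr0_norm.
Qed.

End Curves.

Section SymmetricCurves.
Context {R : realType}.

Lemma itv_partition_mem (a b p : R) s : itv_partition a b s -> p \in a :: s ->
  a <= p <= b.
Proof.
move=> abs pas; rewrite -(nth_index b pas).
by rewrite itv_partition_nth_ge ?itv_partition_nth_le//
  -[X in (_ < X)%N]/(size (a :: s)) index_mem.
Qed.

(** The image of the curve is symmetric, so it passes through - c 0 at some time
    t.  One of the two arcs of the curve between c 0 and - c 0 has length at most
    L / 2.  It is replaced by an inscribed polygon so fine that on each of its
    edges the functional that norms the first end point is almost norming. *)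
Lemma half_curve (X Y : normedModType R) (B : X -> Y -> R) (c : R -> X) L del :
  dual_pairing B -> symmetric_sphere_curve c ->
  (curve_length 0 1 c <= L%:E)%E -> 0 < del ->
  exists (phi : seq Y) l z, [/\ {in phi, forall f, `|f| <= 1}, l <= L / 2 &
    arc (fun x => exists2 f, f \in phi & 1 - del <= B x f) l z (- z)].
Proof.
move=> [[Bl _] Ble BX _] [cc c01 cS _ cN] cL del0.
pose e := del / 2; have e0 : 0 < e by rewrite divr_gt0.
have norm1 p : 0 <= p <= 1 -> `|c p| = 1.
  by move=> p01; apply: cS; exists p => //=; rewrite in_itv.
have [t t01 ct] : exists2 t, 0 <= t <= 1 & c t = - c 0.
  have : (c @` `[0, 1]) (- c 0).
    rewrite -cN; exists (c 0) => //; exists 0 => //=.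
    by rewrite in_itv/= lexx ler01.
  by move=> [t /=]; rewrite in_itv/= => t01 <-; exists t.
have c0N : c 0 != - c 0.
  by rewrite -subr_eq0 opprK -normr_eq0 -mulr2n normrMn norm1 ?lexx ?ler01.
have t0 : 0 < t.
  rewrite lt_neqAle (andP t01).1 andbT; apply: contra_neq c0N => t0.
  by rewrite -ct -t0.
have t1 : t < 1.
  rewrite lt_neqAle (andP t01).2 andbT; apply: contra_neq c0N => t1.
  by rewrite -ct t1 c01.
have [s ts ps] := fine_partition cc e0 (lexx _) t0 (ltW t1).
have [s' ts' ps'] := fine_partition cc e0 (ltW t0) t1 (lexx _).
have lasts : last 0 s = t by case: ts => _ /eqP.
have lasts' : last t s' = 1 by case: ts' => _ /eqP.
have sL : polygon_length 0 t c s + polygon_length t 1 c s' <= L.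
  rewrite -lasts -polygon_length_cat -lee_fin (le_trans _ cL)//.
  apply: ereal_sup_ubound; exists (s ++ s') => //.
  exact: itv_partition_cat ts ts'.
have /choice[f fP] : forall x, exists y : Y, `|x| = 1 -> `|y| <= 1 /\ 1 - e < B x y.
  move=> x; have [x1|x1] := eqVneq `|x| 1; last by exists 0 => /eqP; rewrite (negPf x1).
  have [|y y1 xy] := BX x (1 - e); first by rewrite x1 gtrBl.
  by exists y.
pose phi := [seq f (c p) | p <- (0 :: s) ++ t :: s'].
have in01 p : p \in (0 :: s) ++ t :: s' -> 0 <= p <= 1.
  rewrite mem_cat => /orP[/(itv_partition_mem ts)|/(itv_partition_mem ts')].
    by move=> /andP[-> pt]; rewrite (le_trans pt)// ltW.
  by move=> /andP[tp ->]; rewrite (le_trans _ tp)// ltW.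
have near_phi p x : p \in (0 :: s) ++ t :: s' -> `|x - c p| <= e ->
    exists2 g, g \in phi & 1 - del <= B x g.
  move=> ps01 xp; exists (f (c p)); first exact: map_f.
  have [fp1 cpf] := fP _ (norm1 p (in01 p ps01)).
  have := Ble (c p - x) (f (c p)); rewrite distrC => Bx.
  have {}Bx : B (c p - x) (f (c p)) <= e.
    by rewrite (le_trans Bx)// (le_trans _ xp)// ler_piMr.
  have BE : B (c p) (f (c p)) = B x (f (c p)) + B (c p - x) (f (c p)).
    by have := (Bl (f (c p))).1 x (c p - x); rewrite /= subrKC.
  by move: cpf Bx; rewrite BE /e; lra.
have phi1 : {in phi, forall g, `|g| <= 1}.
  move=> _ /mapP[p ps01 ->].
  by have [] := fP _ (norm1 p (in01 p ps01)).
have arc1 : arc (fun x => exists2 g, g \in phi & 1 - del <= B x g)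
    (polygon_length 0 t c s) (c 0) (c (last 0 s)).
  apply: arc_polygon ps _ (ltW e0) => p x pin.
  by apply: near_phi; rewrite mem_cat pin.
have arc2 : arc (fun x => exists2 g, g \in phi & 1 - del <= B x g)
    (polygon_length t 1 c s') (c t) (c (last t s')).
  apply: arc_polygon ps' _ (ltW e0) => p x pin.
  by apply: near_phi; rewrite mem_cat pin orbT.
rewrite lasts ct in arc1; rewrite lasts' -c01 ct in arc2.
have [le1|le1] := leP (polygon_length 0 t c s) (L / 2).
  by exists phi, (polygon_length 0 t c s), (c 0).
exists phi, (polygon_length t 1 c s'), (- c 0); split=> //; first by lra.
by rewrite opprK.
Qed.

Lemma lipschitz_within_continuous (V : normedModType R) (c : R -> V) k :
  (forall x y, 0 <= x -> x <= y -> y <= 1 -> `|c y - c x| <= k * (y - x)) ->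
  {within `[0, 1], continuous c}.
Proof.
move=> cL; apply/subspace_continuousP => x; rewrite /= in_itv/= => /andP[x0 x1].
apply/cvgrPdist_le => e e0; rewrite near_withinE.
have k1 : 0 < `|k| + 1 by rewrite ltr_wpDl.
have cL' y z : 0 <= y -> y <= z -> z <= 1 -> `|c z - c y| <= (`|k| + 1) * `|z - y|.
  move=> y0 yz z1; rewrite (le_trans (cL _ _ y0 yz z1))// [`|z - y|]ger0_norm ?subr_ge0//.
  by rewrite ler_wpM2r ?subr_ge0// (le_trans (ler_norm _))// lerDl.
apply/nbhs_ballP; exists (e / (`|k| + 1)) => /=; first by rewrite divr_gt0.
move=> y; rewrite /ball/= => xy; rewrite in_itv/= => /andP[y0 y1].
apply: le_trans (_ : (`|k| + 1) * `|x - y| <= _); last first.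
  by rewrite mulrC -ler_pdivlMr// ltW.
have [yx|/ltW xy'] := leP y x; first exact: cL'.
by rewrite distrC [X in _ * X]distrC; exact: cL'.
Qed.

(** The arc followed by its antipode is a symmetric closed curve of length
    2 l. *)
Lemma girth_le_arc (V : normedModType R) l (y : V) :
  arc unit_sphere l y (- y) -> (girth V <= (2 * l)%:E)%E.
Proof.
move=> [g [l0 g0 gl gL gS]].
have l_gt0 : 0 < l.
  rewrite lt_neqAle l0 andbT; apply/eqP => l0'.
  have := gS 0 (lexx _) l0; rewrite /unit_sphere/= => g01.
  have : `|y + y| = 0 by rewrite -[X in _ + X]opprK -gl -l0' g0 subrr normr0.
  by apply/eqP; rewrite -mulr2n normrMn -g0 g01 pnatr_eq0.
have gll : g l = - g 0 by rewrite gl g0.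
pose G t := if t <= l then g t else - g (t - l).
have GL s t : 0 <= s -> s <= t -> t <= 2 * l -> `|G t - G s| <= t - s.
  move=> s0 st tl; rewrite /G; case: (leP t l) => [tl'|lt].
    by rewrite (le_trans st tl') gL.
  case: (leP s l) => [sl|ls]; last first.
    by rewrite -opprD normrN (le_trans (gL _ _ _ _ _)); lra.
  have H1 : `|g l - g s| <= l - s by rewrite gL.
  have H2 : `|g (t - l) - g 0| <= t - l - 0 by rewrite gL//; lra.
  have -> : - g (t - l) - g s = (g l - g s) - (g (t - l) - g 0).
    by rewrite gll opprB addrACA addNr add0r addrC.
  rewrite (le_trans (ler_normB _ _))//; lra.
have GS t : 0 <= t -> t <= 2 * l -> `|G t| = 1.
  move=> t0 tl; rewrite /G; case: (leP t l) => [tl'|lt]; first exact: gS.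
  by rewrite normrN; apply: gS; lra.
have GN t : 0 <= t -> t <= 2 * l -> exists t', [/\ 0 <= t', t' <= 2 * l & G t' = - G t].
  move=> t0 tl; rewrite /G; case: (leP t l) => [tl'|lt]; last first.
    by exists (t - l); split; rewrite ?ifT ?opprK//; lra.
  have [t_gt0|t_le0] := ltP 0 t.
    exists (t + l); split; [lra|lra|].
    by rewrite ifF ?addrK//; apply/negbTE; rewrite -ltNge; lra.
  exists l; split; rewrite ?lexx//; first by lra.
  by rewrite (_ : t = 0)//; lra.
pose c t := G (2 * l * t).
have cL x y' : 0 <= x -> x <= y' -> y' <= 1 -> `|c y' - c x| <= 2 * l * (y' - x).
  move=> x0 xy y1; rewrite mulrBr; apply: GL.
  - by rewrite !mulr_ge0.
  - by rewrite ler_wpM2l// mulr_ge0.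
  - by rewrite ler_piMr// mulr_ge0.
have cLen : (curve_length 0 1 c <= (2 * l)%:E)%E.
  apply: ge_ereal_sup => _ [s s01 <-]; rewrite lee_fin.
  by have := polygon_length_lipschitz s01 cL; rewrite subr0 mulr1.
apply: ge_ereal_inf; exists (curve_length 0 1 c) => //; exists c => //; split.
- exact: (lipschitz_within_continuous cL).
- rewrite /c mulr0 mulr1 /G l0 ifF; last by apply/negbTE; rewrite -ltNge; lra.
  by rewrite (_ : 2 * l - l = l) ?gll ?opprK//; lra.
- move=> _ [t + <-]; rewrite /= in_itv/= => /andP[t0 t1].
  by apply: GS; rewrite ?mulr_ge0// ler_piMr// mulr_ge0.
- by rewrite (le_lt_trans cLen)// ltry.
- have sub : -%R @` (c @` `[0, 1]) `<=` c @` `[0, 1].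
    move=> _ [_ [t /= + <-] <-]; rewrite in_itv/= => /andP[t0 t1].
    have [||t' [t'0 t'l Gt']] := GN (2 * l * t); rewrite ?mulr_ge0 ?ler_piMr ?mulr_ge0//.
    exists (t' / (2 * l)).
      by rewrite /= in_itv/= divr_ge0 ?mulr_ge0//= ler_pdivrMr ?mul1r ?mulr_gt0.
    by rewrite /c mulrC divfK ?gt_eqF ?mulr_gt0.
  apply/seteqP; split=> // x cx; exists (- x); last by rewrite opprK.
  by apply: sub; exists x.
Qed.

End SymmetricCurves.

(** * The girth inequality for a dual pairing *)
Section GirthInequality.
Context {R : realType}.

(** Adding up the losses d k along the polygon, which is closed up to sign, all
    vertices have norms that differ by at most 2 D, hence norms at least the
    average minus 2 D.  In the total cost of the projections of the edges, the
    differences of norms telescope to |Z_n| - |Z_0| = 0. *)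
Lemma arc_of_thin_polygon (V : normedModType R) n (Z : nat -> V) (d : nat -> R) t D :
  Z n.+1 = - Z 0%N -> (forall k, (k <= n)%N -> 0 <= d k) ->
  \sum_(0 <= k < n.+1) d k <= D ->
  (forall k s, (k <= n)%N -> 0 <= s <= 1 -> `|Z k| - d k <= `|segment (Z k) (Z k.+1) s|) ->
  1 - t <= \sum_(0 <= k < n.+1) `|Z k| ->
  0 < (1 - t) / n.+1%:R - 3 * D ->
  exists y : V, arc unit_sphere ((\sum_(0 <= k < n.+1) `|Z k.+1 - Z k| + 2 * D) /
    ((1 - t) / n.+1%:R - 3 * D)) y (- y).
Proof.
move=> Zn d0 dD Zd Zt; set q := (1 - t) / _; set mu := q - 3 * D => mu0.
have ZS k : (k <= n)%N -> `|Z k| - d k <= `|Z k.+1|.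
  by move=> kn; have := Zd k 1 kn; rewrite segment1 lexx ler01; apply.
have Zmono k j : (k <= j)%N -> (j <= n.+1)%N ->
    `|Z k| <= `|Z j| + \sum_(k <= i < j) d i.
  elim: j => [|j IH]; first by rewrite leqn0 => /eqP -> _; rewrite big_geq// addr0.
  rewrite leq_eqVlt => /predU1P[-> _|kj jn]; first by rewrite big_geq// addr0.
  by rewrite big_nat_recr//= (le_trans (IH kj (ltnW jn)))//; have := ZS j jn; lra.
have ZD k j : (k <= j)%N -> (j <= n.+1)%N -> `|Z k| <= `|Z j| + D.
  move=> kj jn; rewrite (le_trans (Zmono _ _ kj jn))// lerD2l.
  apply: le_trans dD; rewrite (@big_cat_nat _ _ _ k 0 n.+1)//=; last exact: leq_trans jn.
  rewrite (@big_cat_nat _ _ _ j k n.+1)//= addrCA lerDl addr_ge0//.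
    rewrite big_nat_cond sumr_ge0// => i /andP[/andP[_ ik] _]; apply: d0.
    by rewrite -ltnS (leq_trans ik)// (leq_trans kj).
  by rewrite big_nat_cond sumr_ge0// => i /andP[/andP[_ ik] _]; exact: d0.
have D0 : 0 <= D.
  by apply: le_trans dD; rewrite big_nat_cond sumr_ge0// => i /andP[/andP[_ ik] _]; exact: d0.
have Zle k j : (k <= n)%N -> (j <= n)%N -> `|Z k| <= `|Z j| + 2 * D.
  move=> kn jn; have [kj|/ltnW jk] := leqP k j.
    by have := ZD k j kj (leqW jn); lra.
  have := ZD k n.+1 (leqW kn) (leqnn _); have := ZD 0%N j (leq0n _) (leqW jn).
  by rewrite Zn normrN; lra.
have Zmu k : (k <= n)%N -> q - 2 * D <= `|Z k|.
  move=> kn; rewrite lerBlDr ler_pdivrMr// (le_trans Zt)//.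
  apply: le_trans (_ : \sum_(0 <= i < n.+1) (`|Z k| + 2 * D) <= _).
    by apply: ler_sum_nat => i /andP[_ ik]; exact: Zle.
  by rewrite sumr_const_nat subn0 mulr_natr.
have dleD k : (k <= n)%N -> d k <= D.
  move=> kn; apply: le_trans dD; rewrite big_mkord (bigD1 (Ordinal (kn : (k < n.+1)%N)))//=.
  by rewrite lerDl sumr_ge0// => i _; apply: d0; rewrite -ltnS.
exists (`|Z 0%N|^-1 *: Z 0%N).
pose l k := (`|Z k.+1 - Z k| + `|Z k.+1| - `|Z k| + 2 * d k) / mu.
have larc k : (k < n.+1)%N ->
    arc unit_sphere (l k) (`|Z k|^-1 *: Z k) (`|Z k.+1|^-1 *: Z k.+1).
  rewrite ltnS => kn; apply: arc_normalize mu0 _ _ => s s0 s1.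
    have := Zd k s kn; rewrite s0 s1 => /(_ isT).
    by have := Zmu k kn; have := dleD k kn; rewrite /mu; lra.
  by apply: Zd; rewrite ?s0.
have S0 : unit_sphere (`|Z 0%N|^-1 *: Z 0%N).
  rewrite /unit_sphere/= normrZ ger0_norm ?invr_ge0// mulVf// gt_eqF//.
  by have := Zmu 0%N isT; rewrite /mu in mu0; lra.
have := @arc_sum _ _ unit_sphere l (fun k => `|Z k|^-1 *: Z k) n.+1 S0 larc.
rewrite Zn normrN scalerN; apply: arc_le.
rewrite /l -mulr_suml ler_pM2r ?invr_gt0//.
rewrite (eq_bigr (fun k => `|Z k.+1 - Z k| + (`|Z k.+1| - `|Z k|) + 2 * d k)); last first.
  by move=> k _; rewrite addrA.
rewrite !big_split/= -big_split/= telescope_sumr// Zn normrN subrr addr0 lerD2l.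
by rewrite -mulr_sumr ler_pM2l.
Qed.

(** The inscribed polygon of the half curve, scaled by 1 / r so that the norming
    functionals reach 1, is cut into N edges of length at most M / N.  With
    eta of order 1 / N^3, the losses satisfy N D <= del for large N: they add up
    to order 1 / N^2, except for the part of order N^2 eta, which the choice of
    eta makes at most del / (2 N), while the norm of the dual polygon is itself
    of order 1 / N. *)
Lemma girth_le_half_curve (X Y : normedModType R) (B : X -> Y -> R) (c : R -> X) L del :
  dual_pairing B -> symmetric_sphere_curve c -> 0 <= L ->
  (curve_length 0 1 c <= L%:E)%E -> 0 < del -> del < 4^-1 ->
  (girth Y <= ((L / (1 - del) ^+ 2 + 4 * del) / (1 - 4 * del))%:E)%E.
Proof.
move=> pB cc L0 cL del0 del4.
have [phi [l [z [phi1 lL [g [l0 g0 gl gL gS]]]]]] := half_curve pB cc cL del0.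
pose r := 1 - del; have r0 : 0 < r by rewrite /r; lra.
have r1 : r < 1 by rewrite /r; lra.
have [U [C [UC C0 phiU]]] := smooth_outer_region pB r0 r1 phi1.
pose M := l / r; have M0 : 0 <= M by rewrite divr_ge0// ltW.
pose n := Num.Def.truncn (2 * C * (M + 1) ^+ 2 / del); pose N : R := n.+1%:R.
have N0 : 0 < N by rewrite ltr0Sn.
have N1 : 1 <= N by rewrite ler1n.
have NC : C * (M + 1) ^+ 2 / N <= del / 2.
  rewrite ler_pdivrMr// mulrAC ler_pdivlMr// [leRHS]mulrC -ler_pdivrMr//.
  by rewrite [_ * 2]mulrC mulrA ltW// truncnS_gt.
pose eta := r * del / (N ^+ 2 * (N + 1)).
have N2 : 0 < N ^+ 2 * (N + 1) by rewrite mulr_gt0 ?exprn_gt0 ?addr_gt0.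
have eta0 : 0 < eta by apply: divr_gt0 => //; exact: mulr_gt0.
have etaN : eta <= 1 / N.
  rewrite /eta ler_pdivrMr//.
  have -> : 1 / N * (N ^+ 2 * (N + 1)) = N * (N + 1) by field; rewrite gt_eqF.
  by rewrite /r; nra.
pose p k := r^-1 *: g (l * (k%:R / N)).
have kN k : (k <= n.+1)%N -> 0 <= l * (k%:R / N) <= l.
  move=> kn; rewrite mulr_ge0 ?divr_ge0 ?(ltW N0)//= ler_piMr//.
  by rewrite ler_pdivrMr// mul1r ler_nat.
have pn : p n.+1 = - p 0%N.
  by rewrite /p mul0r mulr0 divff ?gt_eqF// mulr1 gl g0 scalerN.
have pU k : (k <= n.+1)%N -> U (p k).
  move=> /kN/andP[k0 kl]; have [f fphi gf] := gS _ k0 kl.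
  apply: phiU fphi _; case: (pB) => -[/(_ f)[_ Bl] _] _ _ _.
  by rewrite Bl ler_pdivlMl// mulr1.
have v0P (i : 'I_n.+1) : U (vertex (fun j : 'I_n.+1 => p j.+1 - p j) i.+1).
  by rewrite vertex_of_edges//; exact: pU.
have v0h (j : 'I_n.+1) : `|p j.+1 - p j| <= M / N.
  rewrite /p -scalerBr normrZ ger0_norm ?invr_ge0 ?(ltW r0)//.
  rewrite /M mulrAC [leRHS]mulrC ler_pM2l ?invr_gt0//.
  have /andP[j0 _] := kN j (ltnW (ltn_ord j)).
  have /andP[_ j1] := kN j.+1 (ltn_ord j).
  rewrite (le_trans (gL _ _ j0 _ j1))//.
    by rewrite ler_wpM2l// ler_pM2r ?invr_gt0// ler_nat.
  by rewrite -mulrBr -mulrBl -addn1 natrD addrAC subrr add0r mul1r.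
have [Z [d [Zn Zlen [d0 dD] Zd Zt]]] := discrete_duality pB UC r0 C0 eta0 v0h v0P.
pose D := C * (M / N + eta) ^+ 2 + n.+2%:R * (eta * n.+1%:R / (2 * r)).
pose t := eta * N / (2 * r).
have tE : N * (N + 1) * t = del / 2.
  by rewrite /t /eta; field; rewrite !gt_eqF// addr_gt0.
have t0 : 0 <= t by apply: divr_ge0; apply: mulr_ge0 => //; exact: ltW.
have ND : N * D <= del.
  have -> : D = C * (M / N + eta) ^+ 2 + (N + 1) * t.
    by rewrite /D -[n.+2]addn1 natrD.
  rewrite mulrDr [N * (_ * t)]mulrA tE.
  have H1 : (M / N + eta) ^+ 2 <= ((M + 1) / N) ^+ 2.
    have q0 : 0 <= M / N by rewrite divr_ge0// ltW.
    have q1 : M / N + eta <= (M + 1) / N by rewrite mulrDl lerD2l.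
    have q2 : 0 <= M / N + eta by apply: addr_ge0 => //; exact: ltW.
    by rewrite lerXn2r ?nnegrE// (le_trans q2).
  have H2 : N * (C * (M / N + eta) ^+ 2) <= C * (M + 1) ^+ 2 / N.
    have -> : C * (M + 1) ^+ 2 / N = N * (C * ((M + 1) / N) ^+ 2).
      by field; rewrite gt_eqF.
    by rewrite ler_pM2l// ler_wpM2l.
  by have := le_trans H2 NC; move: (N * _) => w; lra.
have tdel : t <= del.
  have : 1 <= N * (N + 1) by nra.
  by move: tE; nra.
have muE : (1 - 4 * del) / N <= (1 - del) / N - 3 * D.
  by rewrite ler_pdivrMr// mulrBl divfK ?gt_eqF//; lra.
have mu0 : 0 < (1 - 4 * del) / N by rewrite divr_gt0//; lra.
have [|||||y] := @arc_of_thin_polygon Y n Z (fun k => d (inord k)) del D Zn.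
- by [].
- by rewrite big_mkord; under eq_bigr do rewrite inord_val.
- by move=> k s kn; have := Zd (inord k) s; rewrite inordK.
- by rewrite big_mkord; apply: le_trans Zt; rewrite lerD2l lerN2.
- exact: lt_le_trans mu0 muE.
have mu'0 := lt_le_trans mu0 muE.
move=> /girth_le_arc /le_trans; apply; rewrite lee_fin.
set S := (\sum_(_ <= _ < _) _).
have SM : S <= M / N / r by rewrite /S big_mkord.
have D0 : 0 <= D.
  apply: addr_ge0; first by rewrite mulr_ge0// sqr_ge0.
  exact: mulr_ge0.
have S0 : 0 <= S by apply: sumr_ge0.
apply: le_trans (_ : 2 * ((S + 2 * D) / ((1 - 4 * del) / N)) <= _).
  rewrite ler_pM2l// ler_wpM2l//; first by rewrite addr_ge0// mulr_ge0.
  by rewrite lef_pV2.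
have -> : 2 * ((S + 2 * D) / ((1 - 4 * del) / N)) =
    (2 * (S * N) + 4 * (N * D)) / (1 - 4 * del).
  by field; rewrite !gt_eqF//; lra.
rewrite ler_pM2r ?invr_gt0; last by lra.
have SN : S * N <= l / r ^+ 2.
  apply: le_trans (_ : M / N / r * N <= _); first by rewrite ler_pM2r.
  by rewrite /M le_eqVlt; apply/predU1P; left; field; rewrite !gt_eqF.
have lr : 2 * (l / r ^+ 2) <= L / r ^+ 2.
  by rewrite mulrA ler_pM2r ?invr_gt0 ?exprn_gt0//; lra.
rewrite -/r; lra.
Qed.

(** Only the limit del -> 0 remains; del is chosen proportional to the allowed
    error e, with a factor that absorbs the dependence on L. *)
Theorem girth_le_dual_pairing (X Y : normedModType R) (B : X -> Y -> R) :
  dual_pairing B -> (girth Y <= girth X)%E.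
Proof.
move=> pB; apply: le_ereal_inf_tmp => _ [c cc <-].
have [_ _ _ cfin _] := cc.
have : (0%:E <= curve_length 0 1 c)%E.
  apply: le_trans (_ : (polygon_length 0 1 c [:: 1])%:E <= _)%E.
    by rewrite lee_fin sumr_ge0.
  by apply: ereal_sup_ubound; exists [:: 1] => //; exact: itv_partition1.
case E : (curve_length 0 1 c) cfin => [L| |] // _; rewrite lee_fin => L0.
apply/lee_addgt0Pr => e e0.
pose del := e / (8 * (L + e + 1)).
have den0 : 0 < 8 * (L + e + 1) by lra.
have del0 : 0 < del by exact: divr_gt0.
have delE : del * (8 * (L + e + 1)) = e by rewrite divfK ?gt_eqF.
have del8 : del <= 8^-1.
  by rewrite ler_pdivrMr//; lra.
have del4 : del < 4^-1 by lra.
apply: le_trans (girth_le_half_curve pB cc L0 _ del0 del4) _; first by rewrite E.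
rewrite -EFinD lee_fin ler_pdivrMr; last by lra.
have H1 : L / (1 - del) ^+ 2 <= L / (1 - 2 * del).
  rewrite ler_wpM2l// lef_pV2 ?posrE; last 2 first.
  - by apply: exprn_gt0; lra.
  - by lra.
  by nra.
have H2 : L / (1 - 2 * del) <= (L + e) * (1 - 4 * del) - 4 * del.
  by rewrite ler_pdivrMr; nra.
lra.
Qed.

End GirthInequality.

(** * The evaluation pairing *)
Section EvaluationPairing.
Context {R : realType} (X : normedModType R).

(** The cone is the ray of x, with weights that require |x| <= f x. *)
Lemma norming_functional (x : X) :
  exists2 f : dual_space X, `|f| <= 1 & `|x| <= f x.
Proof.
pose K (k : X) (s : R) := exists2 t : R, 0 <= t & k = t *: x /\ s = - (t * `|x|).
have sN : sublinear (fun x : X => `|x|).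
  by split=> [y z|a y a0]; rewrite ?ler_normD// normrZ ger0_norm.
have wK : weighted_cone K.
  split.
  - by exists 0 => //; rewrite scale0r mul0r oppr0.
  - move=> _ _ _ _ [t t0 [-> ->]] [t' t'0 [-> ->]].
    by exists (t + t'); rewrite ?addr_ge0// scalerDl mulrDl opprD.
  - move=> a _ _ a0 [t t0 [-> ->]].
    by exists (a * t); rewrite ?mulr_ge0// scalerA -mulrA mulrN.
have PK k s : K k s -> 0 <= `|k| + s.
  by move=> [t t0 [-> ->]]; rewrite normrZ ger0_norm// subrr.
have [F [[FD FZ] FN FK]] := hahn_banach_cone sN wK PK.
have lF : linear (F : X -> R^o) by move=> a y z; rewrite FD FZ.
have normF y : `|F y| <= `|y|.
  rewrite ler_norml FN andbT lerNl.
  by have := FN (- y); rewrite -scaleN1r FZ mulN1r scaleN1r normrN.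
have cF : continuous (F : X -> R^o).
  pose FL : {linear X -> R^o} := HB.pack (F : X -> R^o)
    (GRing.isLinear.Build R X R^o *:%R (F : X -> R^o) lF).
  apply: (@bounded_linear_continuous _ _ _ FL).
  apply/linear_boundedP; exists 1; split=> // r r1 y.
  by rewrite (le_trans (normF y))// ler_peMl// ltW.
have Fin : (F : X -> R^o) \in @continuous_functional R X by rewrite inE.
exists (Dual Fin).
  by rewrite dual_normE; apply: dual_norm_le => y; exact: le_trans.
have /FK : K x (- `|x|) by exists 1 => //; rewrite scale1r mul1r.
by rewrite subr_ge0.
Qed.

Lemma dual_pairing_eval : dual_pairing (fun (x : X) (f : dual_space X) => f x).
Proof.
have fD (f : dual_space X) x y : f (x + y) = f x + f y by rewrite linearD.
have fZ (f : dual_space X) a x : f (a *: x) = a * f x by rewrite linearZ.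
have fN (f : dual_space X) x : f (- x) = - f x by rewrite linearN.
split.
- by split=> [f|x]; split.
- move=> x f; have [->|x0] := eqVneq x 0; first by rewrite linear0 normr0 mul0r.
  rewrite dual_normE -ler_pdivrMl ?normr_gt0// -fZ.
  rewrite (le_trans (ler_norm _))// dual_norm_ub// normrZ normfV normr_id.
  by rewrite mulVf ?normr_eq0.
- move=> x c cx; have [f f1 xf] := norming_functional x.
  by exists f => //; exact: lt_le_trans xf.
- move=> f c; rewrite dual_normE => cf; apply: contrapT => nx.
  move: cf; apply/negP; rewrite -leNgt; apply: dual_norm_le => x x1.
  have fc y : `|y| <= 1 -> f y <= c.
    by move=> y1; rewrite leNgt; apply/negP => fy; apply: nx; exists y.
  by rewrite ler_norml fc// andbT lerNl -fN fc// normrN.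
Qed.

End EvaluationPairing.

Theorem theorem4p2 (R : realType) (X : normedModType R) :
  girth X = girth (dual_space X).
Proof.
apply/eqP; rewrite eq_le.
rewrite (girth_le_dual_pairing (dual_pairing_eval X)) andbT.
exact: girth_le_dual_pairing (dual_pairing_sym (dual_pairing_eval X)).
Qed.
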